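(* The neutralizing procedure $\Lambda$ is a bijection from $\mathcal{A}_{n,1}$ onto $\mathcal{N}_{n,1}=\{(N,E)\,:\,N\in\mathcal{A}_{n,1}^{0},\ E\in\mathbb{Z},\ -\ell(N)\le E\le c(N)\}$. Moreover, for $A\in\mathcal{A}_{n,1}$ with $\Lambda(A)=(N,E)$: (1) $A\in\mathcal{A}_{n,1}^{0}$ if and only if $N=A$; (2) $\Lambda(\overline{A})=(\overline{N},-E)$; (3) the opening row has the same index $k$ in $A$ and in $N$, and rows $1$ to $k$ of $A$ and $N$ coincide; in particular $r(A)=r(N)$; (4) $i(N)=i(A)$, $E=E(A)$, $B(N)=B(A)+E(A)$ and $J(N)=J(A)$.
   Context: An alternating sign matrix (ASM) of order $n$ is an $n\times n$ matrix $A=(a_{ij})$ with entries in $\{-1,0,1\}$ such that in every row and every column the nonzero entries alternate in sign, the first and the last nonzero entries being $1$. $\mathcal{A}_{n,s}$ denotes the set of order-$n$ ASMs having exactly $s$ entries equal to $-1$ (so $\mathcal{A}_{n,0}$ is the set of $n\times n$ permutation matrices). For an ASM $A=(a_{ij})$: $r(A)$ is the number of entries of the first row lying to the left of its unique nonzero entry (which is a $1$); $i(A)=\sum a_{ij}a_{k\ell}$, the sum over all pairs of positions with $k>i$ and $\ell<j$ (number of inversions); $\overline{A}=(a_{i,n+1-j})$ is the vertical reflection of $A$. Let $A\in\mathcal{A}_{n,1}$. The opening column is the column containing the unique $-1$; the closing row is the row containing the $-1$; the opening row is the row of the $1$ of the opening column lying above the $-1$. The columns strictly to the left (resp. right) of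 the opening column form the left side (resp. right side). The closing row contains exactly two $1$'s, one in each side; the one in the right side is the closing $1$ and its column is the closing column. The rows strictly between the opening row and the closing row are the enclosed rows. $A$ is neutral if there are no enclosed rows; otherwise $A$ is positive if the $1$ of the lowest enclosed row lies in the right side, and negative if it lies in the left side. $\mathcal{A}_{n,1}^{+},\mathcal{A}_{n,1}^{0},\mathcal{A}_{n,1}^{-}$ denote the sets of positive, neutral, negative elements of $\mathcal{A}_{n,1}$; $A$ is negative iff $\overline{A}$ is positive. For $A\in\mathcal{A}_{n,1}^{+}\cup\mathcal{A}_{n,1}^{0}$: the charged cell is the intersection of the enclosed rows with the right side; the extended neutral cell is the intersection of the rows from the opening row to the closing row (inclusive) with the left side. The leading $1$ is the highest $1$ in the left side strictly below the opening row; its column is the leading column; the leading cell consists of the entries strictly below the opening row and strictly between the leading column and the opening column, and $\ell(A)$ is the sum of its entries. The closing cell consists of the entries strictly below the closing row and strictly between the opening column and the closing column, and $c(A)$ is the sum of its entries; the extended closing cell consists of the entries strictly below the closing row in the columns from the opening column to the closing column inclusive. Parameters: if $A$ is positive, $E(A)$ is the sum of the entries of the charged cell; if $A$ is neutral, $E(A)=0$; if $A$ is negative, $E(A)=-E(\overline{A})$. For $A\in\mathcal{A}_{n,1}^{+}\cup\mathcal{A}_{n,1}^{0}$, $B(A)=c(A)-\ell(A)$ and $J(A)=c(A)+\ell(A)+|E(A)|+1$; for $A\in\mathcal{A}_{n,1}^{-}$, $B(A)=-B(\overline{A})$ and $J(A)=J(\overline{A})$. Horizontal displacement: for an $m\times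 q$ $(0,1)$-matrix $P$ whose nonzero columns are $j_1<\dots<j_t$ with $j_1=1$ and $j_t<q$, $H(P)$ is the $m\times q$ matrix whose column $j_{s+1}$ equals column $j_s$ of $P$ for $1\le s\le t$ (where $j_{t+1}=q$), all other columns being zero. Vertical displacement: for an $m\times q$ $(0,1)$-matrix $P$ whose nonzero rows are $i_1<\dots<i_t$ with $i_1>1$ and $i_t=m$, $V(P)$ is the $m\times q$ matrix whose row $i_{s-1}$ equals row $i_s$ of $P$ for $1\le s\le t$ (where $i_0=1$), all other rows being zero. Partial discharging procedure: for $A\in\mathcal{A}_{n,1}^{+}\cup\mathcal{A}_{n,1}^{0}$, $\delta(A)$ is obtained by applying successively the following steps (all cells, rows and columns referring to the positions they occupy in $A$): (1) replace the $-1$ and the closing $1$ by $0$; (2) replace the submatrix occupying the extended closing cell by its image under $H$; (3) replace the submatrix occupying the extended neutral cell by its image under $V$; (4) lower the entries of the extended neutral cell and of the charged cell by one row: in the left side, for each row $t$ strictly below the opening row up to and including the closing row, the left part of row $t$ becomes the former left part of row $t-1$, and the left part of the opening row becomes zero; in the right side, for each row $t$ from two rows below the opening row up to and including the closing row, the right part of row $t$ becomes the former right part of row $t-1$, and the right part of the row immediately below the opening row becomes zero. The complete discharging procedure is $\Delta(A)=(k,\delta(A),c(A),E(A))$, where $k$ is the index of the opening row of $A$. It is known that $\Delta$ is injective on $\mathcal{A}_{n,1}^{+}\cup\mathcal{A}_{n,1}^{0}$, and that whenever $\Delta(A)=(k,P,c,E)$, there is a unique $N\in\mathcal{A}_{n,1}^{+}\cup\mathcal{A}_{n,1}^{0}$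 with $\Delta(N)=(k,P,c+E,0)$, and this $N$ is neutral. Neutralizing procedure $\Lambda$: for $A\in\mathcal{A}_{n,1}^{+}\cup\mathcal{A}_{n,1}^{0}$ with $\Delta(A)=(k,P,c,E)$, $\Lambda(A)=(N,E)$ where $N$ is the unique element with $\Delta(N)=(k,P,c+E,0)$. For $A\in\mathcal{A}_{n,1}^{-}$, write $\Lambda(\overline{A})=(M,-E)$ and set $\Lambda(A)=(\overline{M},E)$. *)

(* Defs.v *)
(* Alternating sign matrices with one -1 and the neutralizing
   procedure Lambda.  Rows/columns are 0-based here (the paper is 1-based). *)
From HB Require Import structures.
From mathcomp Require Import all_boot all_order all_algebra.
Set Implicit Arguments.
Unset Strict Implicit.
Unset Printing Implicit Defensive.
Import Order.TTheory GRing.Theory Num.Theory.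
Local Open Scope ring_scope.

Section ASM.
Variable n : nat.
Implicit Types A : 'M[int]_n.

Definition ent A (i j : nat) : int :=
  match (insub i : option 'I_n), (insub j : option 'I_n) with
  | Some i', Some j' => A i' j'
  | _, _ => 0
  end.

Definition entries_ok A := [forall i, forall j, A i j \in [:: -1; 0; 1]].

Definition alt_seq (s : seq int) :=
  let t := [seq x <- s | x != 0] in
  odd (size t) && (t == mkseq (fun k => (-1) ^+ k) (size t)).

Definition is_ASM A :=
  [&& entries_ok A,
      [forall i : 'I_n, alt_seq [seq A i j | j <- enum 'I_n]] &
      [forall j : 'I_n, alt_seq [seq A i j | i <- enum 'I_n]]].

Definition num_neg A := #|[set p : 'I_n * 'I_n | A p.1 p.2 == -1]|.

Definition in_A1 A := is_ASM A && (num_neg A == 1%N).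

Definition negpos A : nat * nat :=
  if [pick p : 'I_n * 'I_n | A p.1 p.2 == -1] is Some p
  then ((p.1 : nat), (p.2 : nat)) else (0%N, 0%N).

Definition crow A := (negpos A).1.
Definition ocol A := (negpos A).2.
Definition orow A :=
  (\max_(i < n | (i < crow A)%N && (ent A i (ocol A) == 1)) (i : nat))%N.
Definition ccol A :=
  (\max_(j < n | (ocol A < j)%N && (ent A (crow A) j == 1)) (j : nat))%N.

Definition neutral A := crow A == (orow A).+1.
Definition positive A :=
  ((orow A).+1 < crow A)%N &&
  [exists j : 'I_n, (ocol A < j)%N && (ent A (crow A).-1 j == 1)].
Definition negative A :=
  ((orow A).+1 < crow A)%N &&
  [exists j : 'I_n, (j < ocol A)%N && (ent A (crow A).-1 j == 1)].

Definition in_A0 A := in_A1 A && neutral A.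
Definition in_PN A := in_A1 A && (positive A || neutral A).

Definition bar A : 'M[int]_n := \matrix_(i, j) A i (rev_ord j).

Definition rpar A : nat := find (fun j => ent A 0 j != 0) (iota 0 n).

Definition inversions A : int :=
  \sum_(i < n) \sum_(j < n) \sum_(k < n) \sum_(l < n | (i < k)%N && (l < j)%N)
     A i j * A k l.

Definition cellsum A (p : nat -> nat -> bool) : int :=
  \sum_(i < n) \sum_(j < n | p i j) A i j.

Definition charge A :=
  cellsum A (fun i j => (orow A < i < crow A)%N && (ocol A < j)%N).

Definition lrow A : nat :=
  ((orow A).+1 +
   find (fun i => [exists j : 'I_n, (j < ocol A)%N && (ent A i j == 1)])
        (iota (orow A).+1 (n - (orow A).+1)))%N.
Definition lcol A : nat :=
  (\max_(j < n | (j < ocol A)%N && (ent A (lrow A) j == 1)) (j : nat))%N.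

Definition ell A :=
  cellsum A (fun i j => (orow A < i)%N && (lcol A < j < ocol A)%N).
Definition cpar A :=
  cellsum A (fun i j => (crow A < i)%N && (ocol A < j < ccol A)%N).

Definition Epar A : int :=
  if positive A then charge A
  else if negative A then - charge (bar A) else 0.
Definition Bpar A : int :=
  if negative A then - (cpar (bar A) - ell (bar A)) else cpar A - ell A.
Definition Jpar A : int :=
  let A' := if negative A then bar A else A in
  cpar A' + ell A' + `|Epar A'| + 1.

Definition Hdisp (m q : nat) (P : nat -> nat -> int) : nat -> nat -> int :=
  let js := [seq j <- iota 0 q | has (fun i => P i j != 0) (iota 0 m)] in
  let tg := rcons (behead js) q.-1 in
  fun i j => let s := index j tg in
    if (s < size tg)%N then P i (nth 0%N js s) else 0.

Definition Vdisp (m q : nat) (P : nat -> nat -> int) : nat -> nat -> int :=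
  let rs := [seq i <- iota 0 m | has (fun j => P i j != 0) (iota 0 q)] in
  let tg := take (size rs) (0%N :: rs) in
  fun i j => let s := index i tg in
    if (s < size tg)%N then P (nth 0%N rs s) j else 0.

Definition delta_fun A : nat -> nat -> int :=
  let k := orow A in let r := crow A in
  let o := ocol A in let c := ccol A in
  let F1 i j := if (i == r) && ((j == o) || (j == c)) then 0 else ent A i j in
  let H2 := Hdisp (n - r.+1) (c - o).+1 (fun i j => F1 (r.+1 + i)%N (o + j)%N) in
  let F2 i j := if (r < i)%N && (o <= j <= c)%N
                then H2 (i - r.+1)%N (j - o)%N else F1 i j in
  let V3 := Vdisp (r - k).+1 o (fun i j => F2 (k + i)%N j) in
  let F3 i j := if (k <= i <= r)%N && (j < o)%N then V3 (i - k)%N j else F2 i j in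
  fun i j =>
    if (j < o)%N then
      (if (k < i <= r)%N then F3 i.-1 j else if i == k then 0 else F3 i j)
    else if (o < j)%N then
      (if (k.+1 < i <= r)%N then F3 i.-1 j else if i == k.+1 then 0 else F3 i j)
    else F3 i j.

Definition delta A : 'M[int]_n := \matrix_(i, j) delta_fun A i j.

Definition Delta A : nat * 'M[int]_n * int * int :=
  (orow A, delta A, cpar A, Epar A).

(* finite enumeration of {-1,0,1}-matrices, used to select the (unique) N *)
Definition toZ (M : 'M['I_3]_n) : 'M[int]_n :=
  \matrix_(i, j) ((M i j : nat)%:Z - 1).

Definition Lambda_pn A : 'M[int]_n * int :=
  let target := (orow A, delta A, cpar A + Epar A, 0) in
  let N := if [pick M : 'M['I_3]_n | in_PN (toZ M) && (Delta (toZ M) == target)]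
           is Some M then toZ M else A in
  (N, Epar A).

Definition Lambda A : 'M[int]_n * int :=
  if negative A then let p := Lambda_pn (bar A) in (bar p.1, - p.2)
  else Lambda_pn A.

Definition in_N1 (p : 'M[int]_n * int) :=
  in_A0 p.1 && (- ell p.1 <= p.2 <= cpar p.1).

End ASM.

(* Main.v *)
(* Deleting the -1 and the closing 1 leaves a map [f] from rows to columns:
   [f k = f s = o] for the opening row [k] and the lower 1 of the opening column
   [o], the closing row [r] has [f r < o], and the closing column [c] is missed.
   For a positive or neutral matrix [A], the discharged matrix is the permutation
   matrix of some [g0], and [A] is recovered from ([g0], [k], [r], [c]) by a chain
   of elementary moves: each one adds ((-1,1),(1,-1)) in two rows and two columns
   such that the entries in between vanish, which creates exactly one inversion.
   In terms of [g0], [E] counts the entries [g0 i > o] with [k+1 < i <= r] and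
   [c(A)] those with [i > r] and [o < g0 i < c], while [i(A) - E - c(A)] and [l(A)]
   only depend on [g0] and [k].  For fixed [g0] and [k], the pair ([E], [c(A)])
   determines [A], and the nonnegative pairs that occur are exactly those of sum
   less than the number of entries [g0 i > o] with [i > k+1].  Negative matrices are
   handled by reflection, which replaces [i(A)] by a constant minus [i(A)]. *)
Require Import Defs.
From mathcomp Require Import all_boot all_order all_algebra.
From mathcomp Require Import zify ring.
Set Implicit Arguments.
Unset Strict Implicit.
Unset Printing Implicit Defensive.
Import Order.TTheory GRing.Theory Num.Theory.
Local Open Scope ring_scope.

(** * Matrices with a single -1 as maps from rows to columns *)

(** The displacements in [delta] are given by lists of nonzero rows and columns, which are awkward
    to follow on an arbitrary matrix. So the inverse procedure is built by recursion, [climb] for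
    the rows and [spread] for the columns. It is shown to be undone by [delta] and to reach every
    positive or neutral matrix. The two parameters play interchangeable roles because the chain
    consists of exactly E row exchanges and c(A) + 1 column moves: for fixed [g0] and [k] the
    inversion number, like the bound on admissible pairs, involves only E + c(A). Moving charge into
    c(A) at constant sum therefore gives N, and moving it back gives a preimage for each E between 0
    and c(N). Reflection exchanges c and l on neutral matrices, which is where the lower end -l(N)
    of the range comes from. For inversions under reflection, the constant is n(n-1)/2 + 1. *)

Lemma alt_seqE (F : nat -> int) n (l := [seq j <- iota 0 n | F j != 0]) :
  alt_seq [seq F j | j <- iota 0 n] =
  odd (size l) && ([seq F j | j <- l] == mkseq (fun k => (-1) ^+ k) (size l)).
Proof. by rewrite /alt_seq filter_map size_map. Qed.

Lemma iota_splitS n j : (j < n)%N -> iota 0 n = iota 0 j ++ j :: iota j.+1 (n - j.+1).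
Proof. by move=> lt_jn; rewrite -{1}(subnKC (ltnW lt_jn)) iotaD -subnSK. Qed.

Lemma support_sorted (F : nat -> int) n :
  sorted ltn [seq j <- iota 0 n | F j != 0].
Proof. by apply: sorted_filter; [exact: ltn_trans | exact: iota_ltn_sorted]. Qed.

Lemma support_eq (F : nat -> int) n l : sorted ltn l ->
  (forall j, (j \in l) = (j < n)%N && (F j != 0)) ->
  [seq j <- iota 0 n | F j != 0] = l.
Proof.
move=> sl memE; apply: (irr_sorted_eq ltn_trans ltnn) => //.
  exact: support_sorted.
by move=> j; rewrite mem_filter mem_iota add0n /= memE andbC.
Qed.

Lemma alt_one (F : nat -> int) n :
  alt_seq [seq F j | j <- iota 0 n] -> (forall j, (j < n)%N -> F j != -1) ->
  exists2 a, (a < n)%N & F a = 1 /\ forall j, (j < n)%N -> j != a -> F j = 0.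
Proof.
rewrite alt_seqE => alt nneg.
have memE j : (j \in [seq j <- iota 0 n | F j != 0]) = (F j != 0) && (j < n)%N.
  by rewrite mem_filter mem_iota.
case: [seq j <- iota 0 n | F j != 0] alt memE => [|a [|b l]] //.
  move=> /= /eqP[Fa] memE; exists a.
    by move: (memE a); rewrite inE eqxx => /esym /andP[].
  split=> // j jn ja; move: (memE j); rewrite inE (negPf ja) jn andbT.
  by case: eqP.
move=> /andP[_ /= /eqP[_ Fb _]] memE.
have /andP[_ bn] : (F b != 0) && (b < n)%N by rewrite -memE !inE eqxx orbT.
by move: (nneg b bn); rewrite Fb.
Qed.

Lemma alt_three (F : nat -> int) n o :
  alt_seq [seq F j | j <- iota 0 n] -> (o < n)%N -> F o = -1 ->
  (forall j, (j < n)%N -> F j = -1 -> j = o) ->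
  exists a b, [/\ (a < o < b)%N, (b < n)%N, F a = 1, F b = 1 &
    forall j, (j < n)%N -> j != a -> j != o -> j != b -> F j = 0].
Proof.
rewrite alt_seqE => alt lt_on Fo uni.
have memE j : (j \in [seq j <- iota 0 n | F j != 0]) = (F j != 0) && (j < n)%N.
  by rewrite mem_filter mem_iota.
have := support_sorted F n.
case: [seq j <- iota 0 n | F j != 0] alt memE => [|a [|o' [|b [|b' l]]]] //.
- move=> /= /eqP[Fa] memE; have := memE o; rewrite Fo lt_on inE => /eqP oa.
  by move: Fa; rewrite -oa Fo.
- move=> /andP[_ /= /eqP[Fa Fo' Fb]] memE /= /and3P[ao' o'b _].
  have [an o'n bn] : [/\ a < n, o' < n & b < n]%N.
    by split; [have := memE a | have := memE o' | have := memE b];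
       rewrite !inE eqxx ?orbT => /esym /andP[].
  have <- : o' = o by apply: uni.
  exists a, b; split=> //; first by rewrite ao'.
  move=> j jn ja jo jb; move: (memE j).
  by rewrite !inE (negPf ja) (negPf jo) (negPf jb) jn andbT; case: eqP.
(* With four or more nonzero entries, alternation makes both the second and the fourth equal to
   [-1], against [uni]. *)
- move=> /andP[_ /= /eqP[_ Fo' _ Fb' _]] memE /= /and4P[_ lt1 lt2 _].
  have o'n : (o' < n)%N by have := memE o'; rewrite !inE eqxx ?orbT => /esym /andP[].
  have b'n : (b' < n)%N by have := memE b'; rewrite !inE eqxx ?orbT => /esym /andP[].
  have := uni _ o'n Fo'; have := uni _ b'n; rewrite Fb' => /(_ erefl).
  by move: lt1 lt2; lia.
Qed.

Lemma one_alt (F : nat -> int) n a : (a < n)%N -> F a = 1 ->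
  (forall j, (j < n)%N -> j != a -> F j = 0) ->
  alt_seq [seq F j | j <- iota 0 n].
Proof.
move=> an Fa F0; rewrite alt_seqE (@support_eq _ _ [:: a]) //= ?Fa // => j.
rewrite inE; case: (eqVneq j a) => [->|ja]; first by rewrite an Fa.
by case: (ltnP j n) => // jn; rewrite (F0 j jn ja).
Qed.

Lemma three_alt (F : nat -> int) n a o b :
  (a < o < b)%N -> (b < n)%N -> F a = 1 -> F o = -1 -> F b = 1 ->
  (forall j, (j < n)%N -> j != a -> j != o -> j != b -> F j = 0) ->
  alt_seq [seq F j | j <- iota 0 n].
Proof.
move=> /andP[ao ob] bn Fa Fo Fb F0.
rewrite alt_seqE (@support_eq _ _ [:: a; o; b]) //= ?ao ?ob ?Fa ?Fo ?Fb // => j.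
rewrite !inE; case: (eqVneq j a) => [->|ja]; first by rewrite Fa andbT; lia.
case: (eqVneq j o) => [->|jo]; first by rewrite Fo andbT; lia.
case: (eqVneq j b) => [->|jb]; first by rewrite Fb andbT; lia.
by case: (ltnP j n) => // jn; rewrite (F0 j).
Qed.

Lemma entE n (A : 'M[int]_n) (i j : 'I_n) : ent A i j = A i j.
Proof. by rewrite /ent !valK. Qed.

Lemma ent_mx n (F : nat -> nat -> int) i j : (i < n)%N -> (j < n)%N ->
  ent (\matrix_(i < n, j < n) F i j) i j = F i j.
Proof. by move=> lt_i lt_j; rewrite -[i]/(val (Ordinal lt_i)) -[j]/(val (Ordinal lt_j)) entE mxE. Qed.

Lemma ent_inj n (A B : 'M[int]_n) :
  (forall i j, (i < n)%N -> (j < n)%N -> ent A i j = ent B i j) -> A = B.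
Proof. by move=> eqAB; apply/matrixP=> i j; rewrite -!entE eqAB. Qed.

Lemma row_entE n (A : 'M[int]_n) (i : 'I_n) :
  [seq A i j | j <- enum 'I_n] = [seq ent A i j | j <- iota 0 n].
Proof. by rewrite -val_enum_ord -map_comp; apply: eq_map => j /=; rewrite entE. Qed.

Lemma col_entE n (A : 'M[int]_n) (j : 'I_n) :
  [seq A i j | i <- enum 'I_n] = [seq ent A i j | i <- iota 0 n].
Proof. by rewrite -val_enum_ord -map_comp; apply: eq_map => i /=; rewrite entE. Qed.

(** The formula also makes sense for [c = o]: the two corrections cancel and a permutation matrix
    remains. This is the starting point of the chain of column moves. *)
Definition asm_ent (f : nat -> nat) r o c (i j : nat) : int :=
  (f i == j)%:Z - ((i == r) && (j == o))%:Z + ((i == r) && (j == c))%:Z.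

Definition asm n f r o c : 'M[int]_n := \matrix_(i, j) asm_ent f r o c i j.

Record valid n (f : nat -> nat) (k r s o c : nat) : Prop := Valid {
  v_kr : (k < r)%N; v_rs : (r < s)%N; v_sn : (s < n)%N;
  v_fk : f k = o; v_fs : f s = o;
  v_fro : (f r < o)%N; v_oc : (o < c)%N; v_cn : (c < n)%N;
  v_bd : forall i, (i < n)%N -> (f i < n)%N;
  v_c : forall i, (i < n)%N -> f i <> c;
  v_inj : forall i j, (i < n)%N -> (j < n)%N -> f i = f j ->
    [\/ i = j, i = k /\ j = s | i = s /\ j = k] }.

Lemma in_A1_ent n (A : 'M[int]_n) : in_A1 A ->
  [/\ forall i j, (i < n)%N -> (j < n)%N -> ent A i j \in [:: -1; 0; 1],
    forall i, (i < n)%N -> alt_seq [seq ent A i j | j <- iota 0 n],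
    forall j, (j < n)%N -> alt_seq [seq ent A i j | i <- iota 0 n] &
    exists r o, [/\ (r < n)%N, (o < n)%N, ent A r o = -1 &
      forall i j, (i < n)%N -> (j < n)%N -> ent A i j = -1 -> i = r /\ j = o]].
Proof.
case/andP=> /and3P[/'forall_forallP ok /forallP rows /forallP cols] /cards1P[[r o] eqS].
split.
- by move=> i j lti ltj; have := ok (Ordinal lti) (Ordinal ltj); rewrite -entE.
- by move=> i lti; have := rows (Ordinal lti); rewrite row_entE.
- by move=> j ltj; have := cols (Ordinal ltj); rewrite col_entE.
have memS i j : (A i j == -1) = (i == r) && (j == o).
  by have := in_set1 (i, j) (r, o); rewrite -eqS inE /= xpair_eqE => ->.
exists r, o; split; rewrite ?ltn_ord //.
  by rewrite entE; apply/eqP; rewrite memS !eqxx.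
move=> i j lti ltj; have := memS (Ordinal lti) (Ordinal ltj).
by rewrite -entE /= => e /eqP; rewrite e => /andP[/eqP/(congr1 val) /= -> /eqP/(congr1 val) /= ->].
Qed.

Lemma in_A1_valid n (A : 'M[int]_n) : in_A1 A ->
  exists f k r s o c, valid n f k r s o c /\ A = asm n f r o c.
Proof.
move=> /in_A1_ent[ok rows cols [r [o [lt_rn lt_on Aro uni]]]].
have [a [c [/andP[ao oc] cn Ara Arc Ar0]]] :=
  alt_three (rows r lt_rn) lt_on Aro (fun j jn e => (uni r j lt_rn jn e).2).
have [k [s [/andP[kr rs] sn Ako Aso Ao0]]] :=
  alt_three (cols o lt_on) lt_rn Aro (fun i lt_in e => (uni i o lt_in lt_on e).1).
have row1 i : (i < n)%N -> i != r ->
    exists2 b, (b < n)%N & ent A i b = 1 /\ forall j, (j < n)%N -> j != b -> ent A i j = 0.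
  move=> lt_in ir; apply: alt_one => [|j jn]; first exact: rows.
  by apply/eqP=> /uni-/(_ lt_in jn)[e _]; rewrite e eqxx in ir.
have col1 j : (j < n)%N -> j != o ->
    exists2 b, (b < n)%N & ent A b j = 1 /\ forall i, (i < n)%N -> i != b -> ent A i j = 0.
  move=> lt_jn jo; apply: alt_one => [|i lt_in]; first exact: cols.
  by apply/eqP=> /uni-/(_ lt_in lt_jn)[_ e]; rewrite e eqxx in jo.
(* The first [1] of each row. In row [r], the only row with two, it is the one left of the [-1]; the
   other one is recorded by [c]. *)
pose f i := find (fun j => ent A i j == 1) (iota 0 n).
have fP i j : (i < n)%N -> (j < n)%N -> ent A i j = 1 ->
    (forall j', (j' < j)%N -> ent A i j' = 0) -> f i = j.
  move=> lt_in lt_jn A1 A0; rewrite /f (iota_splitS lt_jn) find_cat size_iota.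
  rewrite (_ : has _ _ = false) /= ?A1 ?eqxx ?addn0 //.
  by apply/hasPn=> j'; rewrite mem_iota add0n => /A0 ->.
have fr : f r = a.
  by apply: fP => //; [lia | move=> j ja; apply: Ar0; lia].
have f_other i j : (i < n)%N -> (j < n)%N -> i != r -> (f i == j) = (ent A i j == 1).
  move=> lt_in lt_jn ir; have [b bn [Ab A0]] := row1 i lt_in ir.
  have -> : f i = b by apply: fP => // j' lt; apply: A0; lia.
  by case: (eqVneq b j) => [<-|bj]; rewrite ?Ab // A0 // eq_sym.
have f_bd i : (i < n)%N -> (f i < n)%N.
  move=> lt_in; case: (eqVneq i r) => [->|ir]; first by rewrite fr; lia.
  have [b bn [Ab A0]] := row1 i lt_in ir.
  by rewrite (fP i b) // => j' lt; apply: A0; lia.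
have entA i j : (i < n)%N -> (j < n)%N -> ent A i j = asm_ent f r o c i j.
  move=> lt_in lt_jn; rewrite /asm_ent; case: (eqVneq i r) => [->|ir] /=.
    rewrite fr; case: (eqVneq a j) => [<-|aj].
      by rewrite Ara !ltn_eqF // (ltn_trans ao oc).
    case: (eqVneq j o) => [->|jo]; first by rewrite Aro ltn_eqF.
    by case: (eqVneq j c) => [->|jc]; rewrite ?Arc // Ar0 // eq_sym.
  rewrite f_other // subr0 addr0; have [b bn [Ab A0]] := row1 i lt_in ir.
  by case: (eqVneq j b) => [->|jb]; rewrite ?Ab // A0.
exists f, k, r, s, o, c; split; last first.
  by apply: ent_inj => i j lt_in lt_jn; rewrite /asm ent_mx ?entA.
have fk : f k = o by apply/eqP; rewrite f_other ?Ako //; lia.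
have fs : f s = o by apply/eqP; rewrite f_other ?Aso //; lia.
have fc i : (i < n)%N -> f i <> c.
  move=> lt_in; case: (eqVneq i r) => [->|ir]; first by rewrite fr; lia.
  move/eqP; rewrite f_other // => /eqP Aic.
  have [|b bn [Ab A0]] := col1 c cn; first by lia.
  have := A0 r lt_rn; case: (eqVneq r b) => [rb _|_ /(_ isT)]; last by rewrite Arc.
  by have := A0 i lt_in; rewrite -rb ir Aic => /(_ isT).
split=> //; first by rewrite fr.
move=> i j lt_in lt_jn; case: (eqVneq i j) => [->|ij eqf]; first by constructor 1.
have ent_f i' : (i' < n)%N -> f i' != o -> ent A i' (f i') = 1.
  by move=> lt fo; rewrite entA ?f_bd // /asm_ent eqxx (negPf fo) andbF;
     case: (eqVneq (f i') c) => [/fc|]; rewrite ?andbF //; lia.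
(* Column [o] has its two [1]'s in rows [k] and [s], whence the exceptional cases; any other column
   has a single [1]. *)
case: (eqVneq (f i) o) => [fio|fio].
  have Aoi i' : (i' < n)%N -> f i' = o -> i' = k \/ i' = s.
    move=> lt fo; case: (eqVneq i' k) => [|ik]; first by left.
    case: (eqVneq i' s) => [|is_]; first by right.
    case: (eqVneq i' r) => [e|ir]; first by move: fo; rewrite e fr; lia.
    by move/eqP: fo; rewrite f_other // Ao0.
  have fjo : f j = o by rewrite -eqf.
  case: (Aoi i lt_in fio) (Aoi j lt_jn fjo) => -> [] ->.
  - by constructor 1.
  - by constructor 2.
  - by constructor 3.
  - by constructor 1.
have [|b' bn' [Ab A0]] := col1 (f i) (f_bd i lt_in); first by [].
have e1 : i = b'.
  by apply/eqP; apply/negPn/negP => /(A0 i lt_in); rewrite ent_f.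
have e2 : j = b'.
  by apply/eqP; apply/negPn/negP => /(A0 j lt_jn); rewrite eqf ent_f // -eqf.
by constructor 1; rewrite e1 e2.
Qed.

Lemma injective_onto n (g : nat -> nat) : (forall i, (i < n)%N -> (g i < n)%N) ->
  (forall i j, (i < n)%N -> (j < n)%N -> g i = g j -> i = j) ->
  forall j, (j < n)%N -> exists2 i, (i < n)%N & g i = j.
Proof.
move=> g_bd g_inj j lt_jn; pose G (i : 'I_n) := Ordinal (g_bd i (ltn_ord i)).
have injG : injective G by move=> x y [] /g_inj e; apply: val_inj; apply: e.
have /codomP[i /(congr1 val) /= ->] : Ordinal lt_jn \in codom G by rewrite injF_onto.
by exists i.
Qed.

Lemma big_max_pred1 n (P : pred 'I_n) k : (k < n)%N ->
  (forall i : 'I_n, P i = (i == k :> nat)) -> \max_(i < n | P i) (i : nat) = k.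
Proof. by move=> lt_kn eqP; rewrite (big_pred1 (Ordinal lt_kn)). Qed.

Section Valid.

Variables (n : nat) (f : nat -> nat) (k r s o c : nat).
Hypothesis V : valid n f k r s o c.
Let A := asm n f r o c.

Lemma asm_entE i j : (i < n)%N -> (j < n)%N -> ent A i j = asm_ent f r o c i j.
Proof. exact: ent_mx. Qed.

Lemma valid_onto j : (j < n)%N -> j <> c -> exists2 i, (i < n)%N & f i = j.
Proof.
case: V => kr rs sn fk fs fro oc cn bd fc finj lt_jn jc.
(* Sending [s] to the missed column [c] turns [f] into a permutation. *)
have [i|i i'|i lt_in eqj] := @injective_onto n (fun i => if i == s then c else f i) _ _ j lt_jn.
- by case: eqP => // _; apply: bd.
- move=> lt_in lt_i'n; case: eqP => [->|is_]; case: eqP => [->|i's] //.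
  + by move=> /esym /fc; case.
  + by move=> /fc; case.
  + by move=> /finj[] // [].
- by exists i => //; move: eqj; case: eqP => // _ e; case: jc.
Qed.

Lemma asm_ent1 i j : (asm_ent f r o c i j == 1) = (f i == j) || ((i == r) && (j == c)).
Proof. by case: V => *; rewrite /asm_ent; case: (eqVneq i r) => [->|_]; lia. Qed.

Lemma asm_entN1 i j : (asm_ent f r o c i j == -1) = (i == r) && (j == o).
Proof. by case: V => *; rewrite /asm_ent; case: (eqVneq i r) => [->|_]; lia. Qed.

Lemma asm_ent0 i j : f i != j -> i != r -> asm_ent f r o c i j = 0.
Proof. by rewrite /asm_ent => /negPf -> /negPf ->. Qed.

Lemma asm_ok i j : asm_ent f r o c i j \in [:: -1; 0; 1].
Proof. by case: V => *; rewrite !inE /asm_ent; case: (eqVneq i r) => [->|_]; lia. Qed.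

Lemma asm_row i : (i < n)%N -> alt_seq [seq asm_ent f r o c i j | j <- iota 0 n].
Proof.
case: V => kr rs sn fk fs fro oc cn bd fc finj lt_in.
case: (eqVneq i r) => [->|ir].
  apply: (@three_alt _ _ (f r) o c) => //; first by rewrite fro.
  - by apply/eqP; rewrite asm_ent1 eqxx.
  - by apply/eqP; rewrite asm_entN1 !eqxx.
  - by apply/eqP; rewrite asm_ent1 !eqxx orbT.
  - move=> j lt_jn; rewrite eq_sym /asm_ent => /negPf -> /negPf -> /negPf ->.
    by rewrite !andbF.
apply: (@one_alt _ _ (f i)); first exact: bd.
  by apply/eqP; rewrite asm_ent1 eqxx.
by move=> j _; rewrite eq_sym => ij; apply: asm_ent0.
Qed.

Lemma asm_col j : (j < n)%N -> alt_seq [seq asm_ent f r o c i j | i <- iota 0 n].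
Proof.
case: V => kr rs sn fk fs fro oc cn bd fc finj lt_jn.
case: (eqVneq j o) => [->|jo].
  apply: (@three_alt _ _ k r s) => //; first by rewrite kr.
  - by apply/eqP; rewrite asm_ent1 fk eqxx.
  - by apply/eqP; rewrite asm_entN1 !eqxx.
  - by apply/eqP; rewrite asm_ent1 fs eqxx.
  - move=> i lt_in ik ir is_; apply: asm_ent0 => //; apply/eqP => fio.
    by case: (finj i k); rewrite ?fio //; lia.
case: (eqVneq j c) => [->|jc].
  apply: (@one_alt _ _ r); first by lia.
    by apply/eqP; rewrite asm_ent1 !eqxx orbT.
  by move=> i lt_in ir; apply: asm_ent0 => //; apply/eqP/fc.
have [|i lt_in fij] := valid_onto lt_jn; first exact/eqP.
apply: (@one_alt _ _ i) => //.
  by apply/eqP; rewrite asm_ent1 fij eqxx.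
move=> i' lt_i'n i'i; rewrite /asm_ent (negPf jo) (negPf jc) !andbF subr0 addr0.
case: eqP => // fi'; have e : f i' = f i by rewrite fi'.
have := finj _ _ lt_i'n lt_in e; case; first by move=> e'; rewrite e' eqxx in i'i.
  by case=> ek _; move: fi'; rewrite ek fk => e'; rewrite e' eqxx in jo.
by case=> ek _; move: fi'; rewrite ek fs => e'; rewrite e' eqxx in jo.
Qed.

Lemma asm_in_A1 : in_A1 A.
Proof.
case: V => kr rs sn fk fs fro oc cn bd fc finj.
apply/andP; split; first (apply/and3P; split).
- by apply/'forall_forallP=> i j; rewrite mxE asm_ok.
- apply/forallP=> i; rewrite row_entE.
  have /eq_in_map -> : {in iota 0 n, ent A i =1 asm_ent f r o c i}.
    by move=> j; rewrite mem_iota => /andP[_ lt_jn]; rewrite asm_entE.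
  exact: asm_row.
- apply/forallP=> j; rewrite col_entE.
  have /eq_in_map -> : {in iota 0 n, ent A ^~ j =1 asm_ent f r o c ^~ j}.
    by move=> i; rewrite mem_iota => /andP[_ lt_in]; rewrite asm_entE.
  exact: asm_col.
have lt_rn : (r < n)%N by lia.
have lt_on : (o < n)%N by lia.
apply/cards1P; exists (Ordinal lt_rn, Ordinal lt_on); apply/setP=> -[i j].
by rewrite !inE mxE asm_entN1 xpair_eqE.
Qed.

Lemma asm_negpos : negpos A = (r, o).
Proof.
case: V => kr rs sn fk fs fro oc cn bd fc finj.
have lt_rn : (r < n)%N by lia.
have lt_on : (o < n)%N by lia.
rewrite /negpos; case: pickP => [[i j]|/(_ (Ordinal lt_rn, Ordinal lt_on))] /=.
  by rewrite mxE asm_entN1 => /andP[/eqP -> /eqP ->].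
by rewrite mxE asm_entN1 !eqxx.
Qed.

Lemma asm_crow : crow A = r. Proof. by rewrite /crow asm_negpos. Qed.
Lemma asm_ocol : ocol A = o. Proof. by rewrite /ocol asm_negpos. Qed.

Lemma asm_orow : orow A = k.
Proof.
case: V => kr rs sn fk fs fro oc cn bd fc finj.
apply: big_max_pred1 => [|i]; first by lia.
rewrite asm_crow asm_ocol asm_entE ?ltn_ord ?asm_ent1; try lia.
apply/idP/idP=> [/andP[ir /orP[/eqP fio|]]|/eqP ->]; try lia.
by case: (finj i k); rewrite ?ltn_ord //; lia.
Qed.

Lemma asm_ccol : ccol A = c.
Proof.
case: V => kr rs sn fk fs fro oc cn bd fc finj.
apply: big_max_pred1 => [//|j].
by rewrite asm_crow asm_ocol asm_entE ?ltn_ord ?asm_ent1 ?eqxx; lia.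
Qed.

Lemma asm_neutral : neutral A = (r == k.+1).
Proof. by rewrite /neutral asm_crow asm_orow. Qed.

Lemma asm_positive : positive A = (k.+1 < r)%N && (o < f r.-1)%N.
Proof.
case: V => kr rs sn fk fs fro oc cn bd fc finj.
rewrite /positive asm_crow asm_orow asm_ocol; case: ltnP => //= k1r.
have lt_in : (r.-1 < n)%N by lia.
apply/existsP/idP => [[j]|lt_of].
  by rewrite asm_entE ?ltn_ord // asm_ent1; lia.
by exists (Ordinal (bd _ lt_in)); rewrite asm_entE ?ltn_ord // asm_ent1 /= lt_of eqxx.
Qed.

Lemma asm_negative : negative A = (k.+1 < r)%N && (f r.-1 < o)%N.
Proof.
case: V => kr rs sn fk fs fro oc cn bd fc finj.
rewrite /negative asm_crow asm_orow asm_ocol; case: ltnP => //= k1r.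
have lt_in : (r.-1 < n)%N by lia.
apply/existsP/idP => [[j]|lt_of].
  by rewrite asm_entE ?ltn_ord // asm_ent1; lia.
by exists (Ordinal (bd _ lt_in)); rewrite asm_entE ?ltn_ord // asm_ent1 /= lt_of eqxx.
Qed.

Lemma enclosed_neq i : (k < i < r)%N -> f i <> o.
Proof.
case: V => kr rs sn fk fs fro oc cn bd fc finj ki fio.
by case: (finj i k); rewrite ?fio //; lia.
Qed.

(** The charged, leading and closing cells all avoid the [-1] and the closing [1], so only the [1]'s
    described by [f] contribute and these parameters become counts of rows. *)
Lemma asm_cellsum (p : nat -> nat -> bool) : p r o = false -> p r c = false ->
  cellsum A p = (count (fun i => p i (f i)) (iota 0 n))%:Z.
Proof.
case: V => kr rs sn fk fs fro oc cn bd fc finj pro prc.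
rewrite -sum1_count -natz natr_sum big_mkcond /= -[n in iota 0 n]subn0 -/(index_iota 0 n) big_mkord.
apply: eq_bigr => i _.
transitivity (\sum_(j < n | p i j) ((j == f i :> nat) : nat)%:Z).
  apply: eq_bigr => j pij; rewrite mxE /asm_ent eq_sym.
  have -> : (i == r :> nat) && (j == o :> nat) = false.
    by apply/negP=> /andP[/eqP ir /eqP jo]; rewrite ir jo pro in pij.
  have -> : (i == r :> nat) && (j == c :> nat) = false.
    by apply/negP=> /andP[/eqP ir /eqP jo]; rewrite ir jo prc in pij.
  by rewrite subr0 addr0.
rewrite big_mkcond (bigD1 (Ordinal (bd i (ltn_ord i)))) //= eqxx big1 ?addr0.
  by case: ifP.
move=> j jf; rewrite (_ : (j == f i :> nat) = false) ?if_same //.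
by apply/negP=> /eqP e; case/eqP: jf; apply: val_inj.
Qed.

Lemma asm_cpar : cpar A = (count (fun i => (r < i) && (o < f i < c))%N (iota 0 n))%:Z.
Proof. by rewrite /cpar asm_crow asm_ocol asm_ccol asm_cellsum ?ltnn. Qed.

Lemma asm_charge : charge A = (count (fun i => (k < i < r) && (o < f i))%N (iota 0 n))%:Z.
Proof. by rewrite /charge asm_crow asm_ocol asm_orow asm_cellsum ?ltnn ?andbF. Qed.

(** [q] is the row of the leading [1]; it is at most [r] because the closing row has a [1] in the
    left side. As a parameter it can be [r] for a neutral matrix and a minimum found by search in
    general. *)
Lemma asm_ell q : (k < q <= r)%N -> (f q < o)%N ->
  (forall i, (k < i < q)%N -> (o < f i)%N) ->
  ell A = (count (fun i => (k < i) && (f q < f i < o))%N (iota 0 n))%:Z.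
Proof.
case: V => kr rs sn fk fs fro oc cn bd fc finj /andP[kq qr] fq before.
have leftE i : (i < n)%N ->
    [exists j : 'I_n, (j < ocol A)%N && (ent A i j == 1)] = (f i < o)%N.
  move=> lt_in; rewrite asm_ocol; apply/existsP/idP=> [[j]|fi].
    by rewrite asm_entE ?ltn_ord // asm_ent1; lia.
  by exists (Ordinal (bd _ lt_in)); rewrite asm_entE ?ltn_ord // asm_ent1 /= fi eqxx.
have lrowE : lrow A = q.
  rewrite /lrow asm_orow.
  have -> : (n - k.+1 = q - k.+1 + (n - q.+1).+1)%N by lia.
  rewrite iotaD find_cat size_iota (_ : has _ _ = false) /=.
    by rewrite subnKC // leftE ?fq; lia.
  apply/hasPn=> i; rewrite mem_iota => lti; rewrite leftE; try lia.
  by have := before i; lia.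
rewrite /ell (_ : lcol A = f q) ?asm_orow ?asm_ocol.
  by rewrite asm_cellsum ?ltnn ?andbF //; lia.
apply: big_max_pred1 => [|j]; first by apply: bd; lia.
rewrite lrowE asm_ocol asm_entE ?ltn_ord ?asm_ent1; try lia.
Qed.

(** Reflection exchanges the roles of the two [1]'s of row [r]: the closing one becomes the left
    one. Hence the exception at [r], and the closing column [n.-1 - f r] in [bar_asm]. *)
Definition bar_row i := (n.-1 - (if i == r then c else f i))%N.

Lemma bar_asm : bar A = asm n bar_row r (n.-1 - o)%N (n.-1 - f r)%N.
Proof.
case: V => kr rs sn fk fs fro oc cn bd fc finj.
apply/matrixP=> i j; rewrite !mxE /asm_ent /bar_row /=.
have bdi := bd i (ltn_ord i); have ltj := ltn_ord j.
have rev x : (x < n)%N -> (n - j.+1 == x)%N = (j == n.-1 - x :> nat)%N by move=> ?; lia.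
rewrite ![_ == j :> nat]eq_sym (eq_sym (f i)) !rev //; try lia.
case: (eqVneq (i : nat) r) => [->|_] /=; last by rewrite subr0.
by ring.
Qed.

Lemma bar_valid : valid n bar_row k r s (n.-1 - o)%N (n.-1 - f r)%N.
Proof.
case: V => kr rs sn fk fs fro oc cn bd fc finj.
have bd' i : (i < n)%N -> ((if i == r then c else f i) < n)%N.
  by move=> lt_in; case: eqP => // _; apply: bd.
split=> //; rewrite /bar_row ?eqxx; try lia.
- by rewrite (_ : (k == r) = false) ?fk; lia.
- by rewrite (_ : (s == r) = false) ?fs; lia.
- move=> i lt_in e; have := bd' i lt_in.
  case: (eqVneq i r) e => [_|ir] e _; first by lia.
  have := bd i lt_in; have := bd r; have lt_rn : (r < n)%N by lia.
  move=> /(_ lt_rn) ltr lti; have fir : f i = f r by lia.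
  by case: (finj i r lt_in lt_rn fir); lia.
move=> i j lt_in lt_jn e.
have {e} : (if i == r then c else f i) = (if j == r then c else f j).
  by have := bd' i lt_in; have := bd' j lt_jn; lia.
case: eqP => [->|ir]; case: eqP => [->|jr]; first by constructor 1.
- by move/esym/fc; case.
- by move/fc; case.
- exact: finj.
Qed.

End Valid.

(** * Inversions *)

Definition southwest n (A : 'M[int]_n) (i j : 'I_n) : int :=
  \sum_(k < n) \sum_(l < n) A k l * ((i < k) && (l < j))%N%:Z.

Lemma inversionsE n (A : 'M[int]_n) :
  inversions A = \sum_(i < n) \sum_(j < n) A i j * southwest A i j.
Proof.
apply: eq_bigr => i _; apply: eq_bigr => j _; rewrite big_distrr /=.
apply: eq_bigr => k _; rewrite big_distrr big_mkcond /=; apply: eq_bigr => l _.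
by case: ifP => _; rewrite ?mulr0 ?mulr1.
Qed.

Lemma sum_delta_mx n (u v : 'I_n) (G : 'I_n -> 'I_n -> int) :
  \sum_(i < n) \sum_(j < n) delta_mx u v i j * G i j = G u v.
Proof.
rewrite (bigD1 u) //= [X in _ + X]big1 ?addr0 => [|i /negPf iu]; last first.
  by rewrite big1 // => j _; rewrite mxE iu mul0r.
rewrite (bigD1 v) //= [X in _ + X]big1 => [|j /negPf jv].
  by rewrite !mxE !eqxx mul1r addr0.
by rewrite !mxE jv andbF mul0r.
Qed.

Definition move_mx n (r w a b : 'I_n) : 'M[int]_n :=
  delta_mx r b + delta_mx w a - delta_mx r a - delta_mx w b.

Lemma sum_move_mx n (r w a b : 'I_n) (G : 'I_n -> 'I_n -> int) :
  \sum_(i < n) \sum_(j < n) move_mx r w a b i j * G i j =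
  G r b + G w a - G r a - G w b.
Proof.
rewrite -!(sum_delta_mx _ _ G) -!(sumrN, big_split) /=; apply: eq_bigr => i _.
by rewrite -!(sumrN, big_split) /=; apply: eq_bigr => j _; rewrite !mxE; ring.
Qed.

(* The cross terms vanish because they only involve entries of [B] in the two
   rectangles; the self term of the move contributes 1. *)
Lemma inversions_move n (B : 'M[int]_n) (r w a b : 'I_n) :
  (r < w)%N -> (a < b)%N ->
  (forall i j : 'I_n, (r <= i < w)%N -> (a < j <= b)%N -> B i j = 0) ->
  (forall i j : 'I_n, (r < i <= w)%N -> (a <= j < b)%N -> B i j = 0) ->
  inversions (B + move_mx r w a b) = inversions B + 1.
Proof.
move=> rw ab NE0 SW0; set X := move_mx r w a b.
have swD i j : southwest (B + X) i j = southwest B i j + southwest X i j.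
  rewrite -big_split; apply: eq_bigr => k _; rewrite -big_split.
  by apply: eq_bigr => l _; rewrite mxE mulrDl.
have swX i j : southwest X i j =
    ((i < r) && (b < j))%N%:Z + ((i < w) && (a < j))%N%:Z
    - ((i < r) && (a < j))%N%:Z - ((i < w) && (b < j))%N%:Z.
  by rewrite /southwest sum_move_mx.
have BX0 i j : B i j * southwest X i j = 0.
  rewrite swX; have [/andP[rw' ab']|] := boolP ((r <= i < w) && (a < j <= b))%N.
    by rewrite NE0 // mul0r.
  move=> out; have -> : ((i < r) && (b < j))%N%:Z + ((i < w) && (a < j))%N%:Z
    - ((i < r) && (a < j))%N%:Z - ((i < w) && (b < j))%N%:Z = 0 :> int by lia.
  by rewrite mulr0.
have XB0 : southwest B r b + southwest B w a - southwest B r a - southwest B w b = 0.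
  rewrite /southwest -!(sumrN, big_split) /= big1 // => k _.
  rewrite -!(sumrN, big_split) /= big1 // => l _.
  have [/andP[rw' ab']|out] := boolP ((r < k <= w) && (a <= l < b))%N.
    by rewrite SW0 // !mul0r !subr0 addr0.
  rewrite -!mulrN -!mulrDr.
  have -> : ((r < k) && (l < b))%N%:Z + ((w < k) && (l < a))%N%:Z
    - ((r < k) && (l < a))%N%:Z - ((w < k) && (l < b))%N%:Z = 0 :> int by lia.
  by rewrite mulr0.
rewrite !inversionsE.
transitivity (\sum_(i < n) \sum_(j < n)
   (B i j * southwest B i j + X i j * southwest (B + X) i j)).
  apply: eq_bigr => i _; apply: eq_bigr => j _; rewrite swD !mxE !mulrDl !mulrDr.
  by rewrite BX0 addr0.
under eq_bigr do rewrite big_split; rewrite big_split /=; congr (_ + _).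
rewrite sum_move_mx !swD !swX.
rewrite [LHS](_ : _ = (southwest B r b + southwest B w a - southwest B r a
   - southwest B w b) + 1) ?XB0 // !ltnn; move: rw ab XB0; lia.
Qed.

Lemma sum_ord_split3 n (i : 'I_n) (F : 'I_n -> int) :
  \sum_k F k = \sum_(k < n | (i < k)%N) F k + \sum_(k < n | (k < i)%N) F k + F i.
Proof.
rewrite (bigID (fun k : 'I_n => (i < k)%N)) /= -addrA; congr (_ + _).
rewrite (bigD1 i) ?ltnn //= addrC; congr (_ + _).
by apply: eq_bigl => k; rewrite -leqNgt ltn_neqAle andbC.
Qed.

(** For rows [i < k], the pairs with [l < j], [l > j] and [l = j] together contribute a product of
    two row sums, which is 1. The first two kinds make up the two inversion numbers; the third is
    evaluated by expanding the squares of the column sums. *)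
Lemma inversions_bar n (A : 'M[int]_n) :
  (forall i, \sum_j A i j = 1) -> (forall j, \sum_i A i j = 1) ->
  2 * (inversions A + inversions (bar A)) =
  2 * (\sum_(i < n) \sum_(k < n | (i < k)%N) 1)
  - (n%:Z - \sum_(i < n) \sum_(j < n) A i j ^+ 2).
Proof.
move=> rowA colA.
have invE : inversions A = \sum_(i < n) \sum_(k < n | (i < k)%N)
    \sum_(j < n) \sum_(l < n | (l < j)%N) A i j * A k l.
  apply: eq_bigr => i _; rewrite [RHS]exchange_big /=; apply: eq_bigr => j _.
  rewrite [RHS]big_mkcond /=; apply: eq_bigr => k _; case: ifP => // ik.
  by rewrite big_pred0.
have invbE : inversions (bar A) = \sum_(i < n) \sum_(k < n | (i < k)%N)
    \sum_(j < n) \sum_(l < n | (j < l)%N) A i j * A k l.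
  apply: eq_bigr => i _; rewrite [RHS]exchange_big /= (reindex_inj rev_ord_inj) /=.
  apply: eq_bigr => j _.
  rewrite [RHS]big_mkcond /=; apply: eq_bigr => k _; case: ifP => ik; last by rewrite big_pred0.
  rewrite (reindex_inj rev_ord_inj) /=; apply: eq_big => [l|l _]; last by rewrite !mxE !rev_ordK.
  by have := ltn_ord j; have := ltn_ord l; lia.
have diag : 2 * \sum_(i < n) \sum_(k < n | (i < k)%N) \sum_(j < n) A i j * A k j =
    n%:Z - \sum_(i < n) \sum_(j < n) A i j ^+ 2.
  have -> : n%:Z = \sum_(j < n) (\sum_k A k j) * (\sum_k A k j).
    rewrite (eq_bigr (fun=> 1)) => [|j _]; last by rewrite colA mulr1.
    by rewrite sumr_const card_ord natz.
  have -> : \sum_(j < n) (\sum_k A k j) * (\sum_k A k j) =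
      \sum_i \sum_k \sum_j A i j * A k j.
    under eq_bigr do rewrite big_distrlr /=.
    by rewrite exchange_big /=; apply: eq_bigr => i _; rewrite exchange_big.
  have split3 i : \sum_k \sum_j A i j * A k j =
      \sum_(k < n | (i < k)%N) \sum_j A i j * A k j +
      \sum_(k < n | (k < i)%N) \sum_j A i j * A k j + \sum_j A i j ^+ 2.
    exact: sum_ord_split3.
  under [X in _ = X - _]eq_bigr do rewrite split3; rewrite !big_split /= addrK mulr2n mulrDl mul1r.
  congr (_ + _); rewrite [RHS](exchange_big_dep xpredT) //=.
  by apply: eq_bigr => i _; apply: eq_bigr => k _; apply: eq_bigr => j _; rewrite mulrC.
rewrite -diag -mulrBr; congr (_ * _).
apply/eqP; rewrite -subr_eq0 opprB addrA; apply/eqP.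
rewrite invE invbE -!(sumrN, big_split) /= big1 // => i _.
rewrite -!(sumrN, big_split) /= big1 // => k ik.
have -> : 1 = \sum_j \sum_l A i j * A k l by rewrite -big_distrlr /= !rowA mulr1.
rewrite -!(sumrN, big_split) /= big1 // => j _.
by rewrite (sum_ord_split3 j (fun l => A i j * A k l)); ring.
Qed.

(** * Row, column and square sums of a matrix with a single -1 *)

Lemma sum_ord_eq n a : (a < n)%N -> \sum_(j < n) (a == j :> nat)%:Z = 1.
Proof.
move=> lt_an; rewrite (bigD1 (Ordinal lt_an)) //= eqxx big1 ?addr0 // => j ja.
by rewrite eq_sym (_ : (j == a :> nat) = false) //; apply: negPf.
Qed.

Lemma count_add1 n (p q : pred nat) w : (w < n)%N -> ~~ p w ->
  (forall i, (i < n)%N -> q i = p i || (i == w)) ->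
  count q (iota 0 n) = (count p (iota 0 n)).+1.
Proof.
move=> lt_wn pw eq_q; have /eq_in_count -> : {in iota 0 n, q =1 predU p (pred1 w)}.
  by move=> i; rewrite mem_iota => /eq_q.
have -> : (count p (iota 0 n)).+1 = (count p (iota 0 n) + count (pred1 w) (iota 0 n))%N.
  by rewrite count_uniq_mem ?iota_uniq // mem_iota lt_wn addn1.
rewrite -count_predUI [X in (_ + X)%N](_ : _ = 0%N) ?addn0 //.
apply/eqP; rewrite -leqn0 leqNgt -has_count; apply/hasPn=> i _ /=.
by case: eqP => [->|_]; rewrite ?andbF // andbT.
Qed.

Lemma eq_count_iota n (p q : pred nat) : (forall i, (i < n)%N -> p i = q i) ->
  count p (iota 0 n) = count q (iota 0 n).
Proof. by move=> eqpq; apply: eq_in_count => i; rewrite mem_iota => /eqpq. Qed.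

Section ValidSums.

Variables (n : nat) (f : nat -> nat) (k r s o c : nat).
Hypothesis V : valid n f k r s o c.

Lemma sum_ord_delta a (x : int) : (a < n)%N -> \sum_(i < n) (a == i :> nat)%:Z * x = x.
Proof. by move=> lt_an; rewrite -mulr_suml sum_ord_eq ?mul1r. Qed.

Lemma asm_row_sum (i : 'I_n) : \sum_j asm n f r o c i j = 1.
Proof.
case: V => kr rs sn fk fs fro oc cn bd fc finj.
transitivity (\sum_(j < n) ((f i == j)%:Z - (o == j)%:Z * (i == r :> nat)%:Z
                                     + (c == j)%:Z * (i == r :> nat)%:Z)).
  by apply: eq_bigr => j _; rewrite mxE /asm_ent; lia.
by rewrite !big_split /= sumrN !sum_ord_delta ?sum_ord_eq ?bd ?subrK //; lia.
Qed.

Lemma asm_col_sum (j : 'I_n) : \sum_i asm n f r o c i j = 1.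
Proof.
case: (V) => kr rs sn fk fs fro oc cn bd fc finj.
case: (eqVneq (j : nat) o) => [jo|jo].
  transitivity (\sum_(i < n) ((k == i)%:Z + (s == i)%:Z - (r == i)%:Z)).
    apply: eq_bigr => i _; rewrite mxE /asm_ent jo eqxx.
    have : (f i == o) = (i == k :> nat) || (i == s :> nat).
      apply/eqP/orP=> [fio|[] /eqP -> //].
      by case: (finj i k); rewrite ?fio ?ltn_ord //; lia.
    by move=> ->; lia.
  by rewrite !big_split /= sumrN !sum_ord_eq; lia.
case: (eqVneq (j : nat) c) => [jc|jc].
  transitivity (\sum_(i < n) (r == i)%:Z); last by rewrite sum_ord_eq; lia.
  apply: eq_bigr => i _; rewrite mxE /asm_ent jc.
  by have := fc i (ltn_ord i); lia.
have [|i lt_in fij] := valid_onto V (ltn_ord j); first exact/eqP.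
transitivity (\sum_(i' < n) (i == i')%:Z); last by rewrite sum_ord_eq.
apply: eq_bigr => i' _; rewrite mxE /asm_ent (negPf jo) (negPf jc) !andbF subr0 addr0.
congr (nat_of_bool _)%:Z; apply/eqP/eqP => [fi'|<- //].
have e : f i' = f i by rewrite fi'.
case: (finj _ _ (ltn_ord i') lt_in e) => [//|[ek _]|[ek _]].
  by move: fi' jo; rewrite ek fk => ->; rewrite eqxx.
by move: fi' jo; rewrite ek fs => ->; rewrite eqxx.
Qed.

Lemma asm_square_sum : \sum_(i < n) \sum_(j < n) asm n f r o c i j ^+ 2 = n%:Z + 2.
Proof.
case: V => kr rs sn fk fs fro oc cn bd fc finj.
transitivity (\sum_(i < n) (1 + (r == i :> nat)%:Z * 2)); last first.
  by rewrite big_split /= sumr_const card_ord -natz sum_ord_delta //; lia.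
apply: eq_bigr => i _.
transitivity (\sum_(j < n) ((f i == j)%:Z + (o == j)%:Z * (i == r :> nat)%:Z
                                     + (c == j)%:Z * (i == r :> nat)%:Z)).
  apply: eq_bigr => j _; rewrite mxE /asm_ent.
  case: (eqVneq (i : nat) r) => [->|_] /=; last by rewrite !mulr0; case: (f i == j).
  case: (eqVneq (f r) j) => [e|_]; case: (eqVneq (j : nat) o) => [e'|_];
    case: (eqVneq (j : nat) c) => [e''|_] //=; lia.
rewrite !big_split /= !sum_ord_delta ?sum_ord_eq ?bd //; lia.
Qed.

(** There are n + 2 nonzero entries, so the sum of the two inversion numbers is n(n-1)/2 + 1
    whatever the matrix. This carries statements on inversions over to negative matrices. *)
Lemma inversions_asm_bar :
  2 * (inversions (asm n f r o c) + inversions (bar (asm n f r o c))) =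
  2 * (\sum_(i < n) \sum_(k < n | (i < k)%N) 1) + 2.
Proof.
rewrite inversions_bar ?asm_square_sum; first by ring.
  exact: asm_row_sum.
exact: asm_col_sum.
Qed.

End ValidSums.

Local Open Scope nat_scope.

(** * Undoing the row and column displacements *)

Definition permutes n (g : nat -> nat) :=
  (forall i, (i < n)%N -> (g i < n)%N) /\
  (forall i j, (i < n)%N -> (j < n)%N -> g i = g j -> i = j).

Definition perm_mat n (g : nat -> nat) : 'M[int]_n := \matrix_(i, j) (g i == j :> nat)%:Z.

Lemma asm_perm_mat n g r o : asm n g r o o = perm_mat n g.
Proof. by apply/matrixP=> i j; rewrite !mxE /asm_ent subrK. Qed.

Lemma count_perm n g (p : pred nat) : permutes n g ->
  count (fun i => p (g i)) (iota 0 n) = count p (iota 0 n).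
Proof.
case=> bd inj; rewrite -(count_map g p); apply/permP: p; apply: uniq_perm.
- by rewrite map_inj_in_uniq ?iota_uniq // => i j; rewrite !mem_iota; apply: inj.
- exact: iota_uniq.
move=> j; rewrite mem_iota; apply/mapP/idP => [[i]|lt_jn].
  by rewrite mem_iota => lt_in ->; apply: bd.
by have [i lt_in <-] := injective_onto bd inj lt_jn; exists i; rewrite ?mem_iota.
Qed.

Definition swap_next (g : nat -> nat) a i :=
  if i == a then g a.+1 else if i == a.+1 then g a else g i.

Lemma swap_nextL g a : swap_next g a a = g a.+1.
Proof. by rewrite /swap_next eqxx. Qed.

Lemma swap_nextR g a : swap_next g a a.+1 = g a.
Proof. by rewrite /swap_next eqxx gtn_eqF. Qed.

Lemma swap_nextD g a i : i <> a -> i <> a.+1 -> swap_next g a i = g i.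
Proof. by rewrite /swap_next; do 2![case: eqP => //]. Qed.

Lemma swap_nextK g a i : swap_next (swap_next g a) a i = g i.
Proof.
rewrite /swap_next !eqxx (_ : (a.+1 == a) = false); last by lia.
by case: eqP => [->|_] //; case: eqP => [->|_].
Qed.

Lemma swap_next_perm n g a : (a.+1 < n)%N -> permutes n g -> permutes n (swap_next g a).
Proof.
move=> lt_an [bd inj]; split=> [i lt_in|i j lt_in lt_jn]; rewrite /swap_next.
  by case: eqP => [_|_]; [|case: eqP => [_|_]]; apply: bd; lia.
by do ![case: eqP => ? //=]; move/inj; lia.
Qed.

(** For consecutive rows each rectangle of [inversions_move] lies in a single row, whose only [1] is
    just outside it. *)
Lemma inversions_swap_next n g a : (a.+1 < n)%N -> permutes n g -> (g a < g a.+1)%N ->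
  inversions (perm_mat n (swap_next g a)) = (inversions (perm_mat n g) + 1)%R.
Proof.
move=> lt_an [bd inj] gaa; have lt_an' := ltnW lt_an.
pose r := Ordinal lt_an'; pose w := Ordinal lt_an.
pose x := Ordinal (bd _ lt_an'); pose y := Ordinal (bd _ lt_an).
rewrite -(@inversions_move _ _ r w x y) //=.
- congr inversions; apply/matrixP=> i j; rewrite !mxE /swap_next -!(inj_eq val_inj) /=.
  case: (eqVneq (i : nat) a) => [->|ia] /=.
    rewrite (_ : (a == a.+1) = false); last by lia.
    by rewrite /= !(eq_sym (j : nat)); lia.
  case: (eqVneq (i : nat) a.+1) => [->|ib] /=; last by lia.
  by rewrite !(eq_sym (j : nat)); lia.
- by move=> i j ia gj; rewrite mxE (_ : i = a :> nat); lia.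
- by move=> i j ia gj; rewrite mxE (_ : i = a.+1 :> nat); lia.
Qed.

(** * The row displacement as a chain of exchanges *)

Section Climb.

Variables (n : nat) (g0 : nat -> nat) (k : nat).
Hypotheses (permg : permutes n g0).
Let o := g0 k.

(* Undoes the displacement V and the lowering when the closing row is
   [k + d.+1], as a chain of exchanges of consecutive rows. *)
Fixpoint climb d : nat -> nat :=
  if d is d'.+1 then
    let g := climb d' in
    if (o < g0 (k + d'.+1).+1)%N then swap_next g (k + d'.+1) else g
  else g0.

Lemma climb_perm d : (k + d.+1 < n)%N -> permutes n (climb d).
Proof.
elim: d => [//|d IH] lt_n /=; case: ifP => _; last by apply: IH; lia.
by apply: swap_next_perm; [lia | apply: IH; lia].
Qed.

Lemma climb_out d i : (i <= k)%N || (k + d.+1 < i)%N -> climb d i = g0 i.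
Proof.
elim: d => [//|d IH] /= out; rewrite -IH; last by lia.
by case: ifP => // _; rewrite swap_nextD //; lia.
Qed.

Hypothesis left1 : (g0 k.+1 < o)%N.

Lemma climb_neq d i : (k + d.+1 < n)%N -> (k < i < n)%N -> climb d i <> o.
Proof.
move=> lt_n ki; rewrite -[o](@climb_out d k) ?leqnn // => e.
by have [_ inj] := climb_perm lt_n; have := inj i k; lia.
Qed.

(** The left entry of the closing row travels down with it: if the next row has its entry on the
    right, the exchange brings the left one down, and otherwise the next row has a left entry
    already. [left1] starts the induction. *)
Lemma climb_last d : (k + d.+1 < n)%N -> (climb d (k + d.+1) < o)%N.
Proof.
elim: d => [|d IH] lt_n; first by rewrite addn1.
have lt_n' : (k + d.+1 < n)%N by lia.
rewrite [in X in (X < _)%N]addnS /=.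
case: (ltnP o (g0 (k + d.+1).+1)) => [_|le_o].
  by rewrite swap_nextR IH.
rewrite climb_out; last by lia.
have := @climb_neq d (k + d.+1).+1 lt_n'; rewrite climb_out; last by lia.
by lia.
Qed.

(** An entry on the right is raised by one row when it is met, and later exchanges take place
    strictly below it. This is what the lowering in the right side undoes. *)
Lemma climb_right d i : (k + d.+1 < n)%N -> (k < i < k + d.+1)%N ->
  (o < g0 i.+1)%N -> climb d i = g0 i.+1.
Proof.
elim: d => [|d IH] lt_n ki lt_o; first by lia.
case: (eqVneq i (k + d.+1)%N) => [ei|ei].
  by rewrite /= -ei lt_o swap_nextL climb_out //; lia.
rewrite -(IH _ _ lt_o); try lia.
by rewrite /=; case: ifP => // _; rewrite swap_nextD //; lia.
Qed.

Lemma climb_left d i : (k + d.+1 < n)%N -> (k < i < k + d.+1)%N ->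
  (g0 i.+1 <= o)%N -> (climb d i < o)%N.
Proof.
elim: d => [|d IH] lt_n ki le_o; first by lia.
case: (eqVneq i (k + d.+1)%N) => [ei|ei].
  by rewrite /= -ei (ltnNge o) le_o /= ei climb_last //; lia.
have lt_i : climb d i < o by apply: IH => //; lia.
by rewrite /=; case: ifP => // _; rewrite swap_nextD //; lia.
Qed.

(** Here [p] and [q] are consecutive left rows, [p] being possibly the opening row, as in the
    definition of [V]; the passage from [p] to [p.+1] is the lowering by one row. *)
Lemma climb_next d p q : (k + d.+1 < n)%N -> (k <= p < q)%N -> (q <= k + d.+1)%N ->
  (p = k \/ climb d p < o)%N -> (climb d q < o)%N ->
  (forall i, (p < i < q)%N -> (o < climb d i)%N) -> climb d q = g0 p.+1.
Proof.
elim: d p q => [|d IH] p q lt_n kp le_q Hp Hq btw.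
  by rewrite (_ : q = p.+1) //; lia.
have lt_n' : (k + d.+1 < n)%N by lia.
case: (ltnP o (g0 (k + d.+1).+1)) => [lt_o|le_o]; last first.
  have E i : climb d.+1 i = climb d i by rewrite /= (ltnNge o) le_o.
  rewrite E; case: (eqVneq q (k + d.+2)%N) => [eq_q|neq_q].
    (* Without an exchange the former closing row keeps its left entry, so it is the left row just
       before [q]. *)
    have <- : (k + d.+1 = p)%N.
      apply/eqP/negPn/negP=> neq_p; have := btw (k + d.+1)%N; rewrite E.
      by have := climb_last lt_n'; lia.
    by rewrite climb_out ?eq_q ?addnS //; lia.
  apply: IH => //; try lia; last by move=> i /btw; rewrite E.
    by move: Hp; rewrite E.
  by rewrite -E.
have Er : climb d.+1 (k + d.+1)%N = g0 (k + d.+1).+1.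
  by rewrite /= lt_o swap_nextL climb_out //; lia.
have ErS : climb d.+1 (k + d.+2)%N = climb d (k + d.+1)%N.
  by rewrite [in LHS]addnS /= lt_o swap_nextR.
have E i : (i < k + d.+1)%N -> climb d.+1 i = climb d i.
  by move=> lti; rewrite /= lt_o swap_nextD //; lia.
have neq_p : p <> (k + d.+1)%N.
  move=> ep; case: Hp => [ek|]; first by lia.
  by rewrite ep Er; lia.
have Hp' : (p < k + d.+1)%N -> (p = k \/ climb d p < o)%N.
  by move=> ltp; move: Hp; rewrite E.
(* After an exchange the last left row is one lower than before, so the induction hypothesis is
   applied to [k + d.+1] in place of [q]. *)
case: (eqVneq q (k + d.+2)%N) => [eq_q|neq_q].
  rewrite eq_q ErS; apply: IH => //; try lia.
  - exact: climb_last.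
  - by move=> i lti; rewrite -E ?btw //; lia.
have neq_q' : q <> (k + d.+1)%N by move=> eq; move: Hq; rewrite eq Er; lia.
rewrite E; last by lia.
apply: IH => //; try lia.
- by rewrite -E //; lia.
- by move=> i lti; rewrite -E ?btw //; lia.
Qed.

Lemma count_climb d : (k + d.+1 < n)%N ->
  count (fun i => (k < i < k + d.+1) && (o < climb d i))%N (iota 0 n) =
  count (fun i => (k.+1 < i <= k + d.+1) && (o < g0 i))%N (iota 0 n).
Proof.
elim: d => [|d IH] lt_n; first by apply: eq_count_iota => i _; lia.
have lt_n' : (k + d.+1 < n)%N by lia.
have E i : (i < k + d.+1)%N -> climb d.+1 i = climb d i.
  by move=> lti; rewrite /=; case: ifP => // _; rewrite swap_nextD //; lia.
case: (ltnP o (g0 (k + d.+1).+1)) => [lt_o|le_o].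
  have lt_o2 : o < g0 (k + d.+2) by rewrite addnS.
  have Er : climb d.+1 (k + d.+1)%N = g0 (k + d.+1).+1.
    by rewrite /= lt_o swap_nextL climb_out //; lia.
  rewrite (@count_add1 _ (fun i => (k < i < k + d.+1) && (o < climb d i))%N _ (k + d.+1)%N) //.
  - rewrite IH // -(@count_add1 _ _ (fun i => (k.+1 < i <= k + d.+2) && (o < g0 i))%N (k + d.+2)%N) //.
    + by lia.
    + by move=> i lti; case: (eqVneq i (k + d.+2)%N) => [->|ne]; rewrite ?orbT ?orbF ?lt_o2; lia.
  - by lia.
  - by move=> i lti; case: (eqVneq i (k + d.+1)%N) => [->|ne]; rewrite ?Er ?orbT ?orbF ?lt_o;
      [lia | case: (ltnP i (k + d.+1)) => lti'; [rewrite E|]; lia].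
rewrite (@eq_count_iota _ _ (fun i => (k < i < k + d.+1) && (o < climb d i))%N); last first.
  move=> i lti; case: (eqVneq i (k + d.+1)%N) => [->|ne].
    rewrite (_ : climb d.+1 _ = climb d (k + d.+1)); last by rewrite /= (ltnNge o) le_o.
    by have := climb_last lt_n'; lia.
  by case: (ltnP i (k + d.+1)) => lti'; [rewrite E|]; lia.
rewrite IH //; apply: eq_count_iota => i lti.
by case: (eqVneq i (k + d.+2)%N) => [->|ne]; [rewrite addnS|]; lia.
Qed.

Lemma inversions_climb d : (k + d.+1 < n)%N ->
  inversions (perm_mat n (climb d)) = (inversions (perm_mat n g0) +
    (count (fun i => (k.+1 < i <= k + d.+1) && (o < g0 i))%N (iota 0 n))%:Z)%R.
Proof.
elim: d => [|d IH] lt_n.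
  rewrite (@eq_count_iota _ _ pred0) ?count_pred0 ?addr0 // => i _ /=; lia.
have lt_n' : (k + d.+1 < n)%N by lia.
case: (ltnP o (g0 (k + d.+1).+1)) => [lt_o|le_o].
  have lt_o2 : o < g0 (k + d.+2) by rewrite addnS.
  rewrite (@count_add1 _ (fun i => (k.+1 < i <= k + d.+1) && (o < g0 i))%N _ (k + d.+2)%N) //.
  - rewrite intS (addrC 1%R) addrA -IH //= lt_o inversions_swap_next //; try lia.
      exact: climb_perm.
    by rewrite [X in (_ < X)%N]climb_out ?(ltn_trans (climb_last lt_n')) //; lia.
  - by lia.
  - by move=> i lti; case: (eqVneq i (k + d.+2)%N) => [->|ne]; rewrite ?orbT ?orbF ?lt_o2; lia.
rewrite /= (ltnNge o) le_o /= IH //; congr (_ + _%:Z)%R; apply: eq_count_iota => i lti.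
by case: (eqVneq i (k + d.+2)%N) => [->|ne]; [rewrite addnS|]; lia.
Qed.

End Climb.

(** The chain can be undone step by step because the result shows what the last step was: the row
    just above the closing row carries a right entry after an exchange and a left entry
    otherwise. *)
Lemma climb_onto n k d g : permutes n g -> (k + d.+1 < n)%N -> (g (k + d.+1) < g k)%N ->
  exists g0, [/\ permutes n g0, (g0 k.+1 < g0 k)%N, forall i, (i <= k)%N -> g0 i = g i &
                 climb g0 k d =1 g].
Proof.
elim: d g => [|d IH] g permg lt_n lt_o.
  by exists g; split=> //; rewrite -[k.+1]addn1.
have lt_n' : (k + d.+1 < n)%N by lia.
case: (ltnP (g (k + d.+1)%N) (g k)) => [lt_o'|le_o].
  have [g0 [perm0 left0 top0 eq0]] := IH g permg lt_n' lt_o'.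
  exists g0; split=> // i /=; rewrite top0 // -(@climb_out g0 k d) ?eq0; last by lia.
  by rewrite -addnS ltnNge ltnW.
have [||g0 [perm0 left0 top0 eq0]] := IH (swap_next g (k + d.+1)) _ lt_n'.
- by apply: swap_next_perm => //; lia.
- by rewrite /swap_next; do ![case: eqP => ? //]; move: lt_o; rewrite ?addnS; lia.
have top i : (i <= k)%N -> g0 i = g i.
  by move=> le_ik; rewrite top0 // /swap_next; do ![case: eqP => ? //]; lia.
exists g0; split=> // i /=.
have -> : g0 (k + d.+1).+1 = g (k + d.+1)%N.
  rewrite -(@climb_out g0 k d) ?eq0; last by lia.
  by rewrite swap_nextR.
rewrite top // ltn_neqAle le_o andbT.
case: eqP => [e|_] /=.
  by case: permg => _ inj; have := inj k (k + d.+1)%N; lia.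
rewrite -[RHS](swap_nextK g (k + d.+1)).
by rewrite [LHS]/swap_next [RHS]/swap_next !eq0.
Qed.

(** * The column displacement as a chain of moves *)

Section Spread.

Variables (n : nat) (g : nat -> nat) (r o : nat).

(* Undoes the displacement H in the columns from [o] to [o + e].  The second
   component is the column of the closing 1: the last one, up to [o + e], with a
   1 below row [r] (and [o] if there is none, when no -1 has been created yet). *)
Fixpoint spread e : (nat -> nat) * nat :=
  if e is e'.+1 then
    if has (fun i => (r < i) && (g i == o + e)) (iota 0 n)
    then (fun i => if (r < i) && (g i == o + e) then (spread e').2 else (spread e').1 i,
          o + e)
    else spread e'
  else (g, o).

(** In [SpreadLow], row [w] cedes its column to the closing [1] and takes over the previous closing
    column. In [SpreadHigh], the new column has no [1] below row [r] and is skipped. *)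
Variant spread_step_spec e : (nat -> nat) * nat -> Prop :=
| SpreadLow w f of r < w < n & g w = o + e.+1 &
    (forall i, i < n -> f i = if i == w then (spread e).2 else (spread e).1 i) :
    spread_step_spec e (f, o + e.+1)
| SpreadHigh of (forall i, r < i < n -> g i <> o + e.+1) :
    spread_step_spec e (spread e).

Variables (k : nat).
Hypotheses (permg : permutes n g) (kr : k < r) (lt_rn : r < n) (gk : g k = o) (gr : g r < o).

Lemma spread_stepP e : spread_step_spec e (spread e.+1).
Proof.
rewrite /=; case: hasP => [[w]|high].
  rewrite mem_iota => /andP[_ lt_wn] /andP[rw /eqP gw]; apply: (@SpreadLow _ w) => //.
    by rewrite rw.
  move=> i lt_in; congr (if _ then _ else _); apply/idP/eqP => [/andP[_ /eqP gi]|->].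
    by case: permg => _; apply => //; rewrite gi gw.
  by rewrite rw gw eqxx.
constructor=> i /andP[ri lt_in] gi; case: high; exists i; first by rewrite mem_iota.
by rewrite ri gi eqxx.
Qed.

Lemma perm_inj i j : i < n -> j < n -> g i = g j -> i = j.
Proof. by case: permg => _; apply. Qed.

Lemma perm_neq i j : i < n -> j < n -> i <> j -> g i <> g j.
Proof. by move=> lt_in lt_jn ij /perm_inj; auto. Qed.

Lemma spread_last e : o <= (spread e).2 <= o + e.
Proof. by elim: e => [|e IH]; [rewrite /=|case: spread_stepP => * /=]; lia. Qed.

Lemma spread_last_max e i : r < i < n -> (spread e).2 < g i -> o + e < g i.
Proof.
move=> ri; elim: e => [|e IH]; first by rewrite addn0.
case: spread_stepP => [//|high] /IH; have := high i ri; lia.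
Qed.

Lemma spread_last_low e : (spread e).2 = o \/ exists2 i, r < i < n & g i = (spread e).2.
Proof.
elim: e => [|e IH]; first by left.
by case: spread_stepP => [w f rw gw _|//]; right; exists w.
Qed.

Lemma spread_out e i : i < n -> (i <= r) || (g i <= o) || (o + e < g i) ->
  (spread e).1 i = g i.
Proof.
elim: e => [//|e IH] lt_in out.
case: spread_stepP => [w f rw gw fE|high] /=; last by apply: IH => //; lia.
rewrite fE //; case: eqP => [ei|_]; last by apply: IH => //; lia.
by rewrite ei in out *; lia.
Qed.

(** Row-wise form of the inverse of [H]: an entry below row [r] moves left to the preceding column
    that has such an entry, or to [o] if there is none after [o]. *)
Lemma spread_in e i : r < i < n -> o < g i <= o + e ->
  [/\ o <= (spread e).1 i < g i,
      forall i', r < i' < n -> (spread e).1 i < g i' -> g i <= g i' &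
      (spread e).1 i = o \/ exists2 i', r < i' < n & g i' = (spread e).1 i].
Proof.
elim: e => [|e IH] ri gi; first by lia.
case: spread_stepP => [w f rw gw fE|high] /=; last first.
  by apply: IH => //; have := high i ri; lia.
rewrite fE; last by lia.
case: eqP => [->|ne].
  split; [by have := spread_last e; lia| |exact: spread_last_low].
  by move=> i' ri' /(spread_last_max ri'); lia.
have gne : g i <> g w by apply: perm_neq ne; lia.
by apply: IH => //; lia.
Qed.

Lemma spread_cover e j : o <= j < (spread e).2 ->
  j = o \/ (exists2 i, r < i < n & g i = j) ->
  exists2 i, r < i < n & (spread e).1 i = j.
Proof.
elim: e j => [|e IH] j; first by rewrite /=; lia.
case: spread_stepP => [w f rw gw fE|high] //= oj jlow; last exact: IH.
case: (ltngtP j (spread e).2) => [lt_j|gt_j|->].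
- have [|i ri Fi] := IH j _ jlow; first by lia.
  exists i; rewrite ?fE //; last by lia.
  case: eqP => // ew; move: Fi; rewrite ew spread_out ?gw; lia.
- case: jlow => [|[i ri gi]]; first by have := spread_last e; lia.
  by have := spread_last_max ri (e := e); lia.
- by exists w => //; rewrite fE ?eqxx //; lia.
Qed.

Lemma spread_valid e : ((spread e).2 = o /\ forall i, i < n -> (spread e).1 i = g i) \/
  exists s, valid n (spread e).1 k r s o (spread e).2.
Proof.
case: (permg) => bd inj; elim: e => [|e IH]; first by left.
case: spread_stepP => [w f rw gw fE|high] //=; right.
have Fw : (spread e).1 w = o + e.+1 by rewrite spread_out //; lia.
have oL := spread_last e.
have bdw : o + e.+1 < n by rewrite -gw; apply: bd; lia.
have neqw i : i < n -> i != w -> (spread e).1 i <> o + e.+1.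
  move=> lt_in iw Fi; case: (leqP (g i) o) => [go|og].
    by move: Fi; rewrite spread_out ?go ?orbT //; lia.
  case: (leqP i r) => [ir|ri].
    by move: Fi; rewrite spread_out ?ir // -gw => /(inj _ _ lt_in); lia.
  case: (leqP (g i) (o + e)) => [ge|eg].
    by have [||] := @spread_in e i; rewrite ?ri ?og ?Fi //; lia.
  by move: Fi; rewrite spread_out ?eg ?orbT // -gw => /(inj _ _ lt_in); lia.
have fk : f k = o by rewrite fE; [case: eqP => [|_]; [|rewrite spread_out]; lia | lia].
have fr : f r < o by rewrite fE; [case: eqP => [|_]; [|rewrite spread_out]; lia | lia].
case: IH => [[L_o FE]|[s [_ rs sn Fk Fs Fr oc cn Fbd Fc Finj]]].
  (* The first row that moves takes over column [o] and becomes the row of the lower [1] of the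
     opening column; later moves leave it in place. *)
  exists w; split=> //; try lia.
  - by rewrite fE ?eqxx //; lia.
  - by move=> i lt_in; rewrite fE //; case: eqP => _; [lia | rewrite FE // bd].
  - by move=> i lt_in; rewrite fE //; case: eqP => [_|/eqP]; [lia | apply: neqw].
  - move=> i j lt_in lt_jn; rewrite !fE // L_o; case: (eqVneq i w) => [->|iw];
      case: (eqVneq j w) => [->|jw]; rewrite ?FE //.
    + by constructor 1.
    + by rewrite -gk => /inj <-; [constructor 3|lia|].
    + by rewrite -gk => /inj ->; [constructor 2| |lia].
    + by move/inj => ->; [constructor 1| |].
have ws : w <> s by move=> e'; move: Fw; rewrite e' Fs; lia.
exists s; split=> //; try lia.
- by rewrite fE // (_ : s == w = false) //; lia.
- by move=> i lt_in; rewrite fE //; case: eqP => _; [lia | apply: Fbd].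
- by move=> i lt_in; rewrite fE //; case: eqP => [_|/eqP]; [lia | apply: neqw].
- move=> i j lt_in lt_jn; rewrite !fE //; case: (eqVneq i w) => [->|iw];
    case: (eqVneq j w) => [->|jw].
  + by constructor 1.
  + by move=> e'; have := Fc j lt_jn; rewrite -e'.
  + by move=> /Fc; case.
  + exact: Finj.
Qed.

Lemma count_spread e :
  count (fun i => (r < i) && (o <= (spread e).1 i < (spread e).2)) (iota 0 n) =
  count (fun i => (r < i) && (o < g i <= (spread e).2)) (iota 0 n).
Proof.
elim: e => [|e IH]; first by apply: eq_count_iota => i lt_in /=; lia.
case: spread_stepP => [w f rw gw fE|high] //=.
have oL := spread_last e; have maxL := fun i => @spread_last_max e i.
rewrite (@count_add1 _ (fun i => (r < i) && (o <= (spread e).1 i < (spread e).2))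
  _ w); first rewrite IH; first symmetry.
- apply: (@count_add1 _ _ _ w); rewrite ?gw; try lia.
  move=> i lt_in; case: (eqVneq i w) => [->|iw]; first by rewrite gw; lia.
  have : g i <> g w by apply: perm_neq; lia.
  by have := maxL i; lia.
- lia.
- by rewrite spread_out; lia.
move=> i lt_in; rewrite fE //; case: (eqVneq i w) => [->|iw]; first by lia.
rewrite orbF; case: (ltnP r i) => //= ri.
have : (spread e).1 i < (spread e).2 \/ o + e.+1 < (spread e).1 i \/ (spread e).1 i < o.
  case: (leqP (g i) o) => [go|og].
    have : g i <> o by rewrite -gk; apply: perm_neq; lia.
    by rewrite spread_out ?go ?orbT //; lia.
  have : g i <> g w by apply: perm_neq; lia.
  case: (leqP (g i) (o + e)) => [ge|eg]; last by rewrite spread_out; lia.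
  have [||] := @spread_in e i; try lia.
  by move=> ? _ _; have := maxL i; lia.
lia.
Qed.

(** Each effective step is a move in rows [r], [w] and columns [l], [o + e.+1]: the closing [1]
    leaves [l] and the [1] of row [w] enters it. In the first one [l = o], and the unit subtracted
    in row [r] creates the [-1]. *)
Lemma inversions_spread e :
  inversions (asm n (spread e).1 r o (spread e).2) = (inversions (perm_mat n g) +
    (count (fun i => (r < i) && (o < g i <= (spread e).2))%N (iota 0 n))%:Z)%R.
Proof.
elim: e => [|e IH].
  rewrite /= asm_perm_mat (@eq_count_iota _ _ pred0) ?count_pred0 ?addr0 // => i _ /=; lia.
have := spread_valid e; have oL := spread_last e; have maxL := fun i => @spread_last_max e i.
case: spread_stepP => [w f rw gw fE|high] //= Fvalid.
set l := (spread e).2 in IH oL maxL fE Fvalid *; set F := (spread e).1 in IH fE Fvalid *.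
have Fw : F w = o + e.+1 by rewrite /F spread_out //; lia.
have lt_wn : w < n by lia.
have lt_cn : o + e.+1 < n by rewrite -gw; case: permg => bd _; apply: bd.
have lt_ln : l < n by lia.
rewrite (@count_add1 _ (fun i => (r < i) && (o < g i <= l)) _ w) //; first last.
- move=> i lt_in; case: (eqVneq i w) => [->|iw]; first by rewrite gw; lia.
  have : g i <> g w by apply: perm_neq; lia.
  by have := maxL i; lia.
- by rewrite gw; lia.
rewrite intS (addrC 1%R) addrA -IH.
rewrite -(@inversions_move _ _ (Ordinal lt_rn) (Ordinal lt_wn) (Ordinal lt_ln) (Ordinal lt_cn)) //=.
- congr inversions; apply/matrixP=> i j; rewrite !mxE /asm_ent fE // -!(inj_eq val_inj) /=.
  by case: (eqVneq (i : nat) w) => [->|iw]; rewrite ?Fw; lia.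
- lia.
- lia.
- move=> i j ri lj; rewrite mxE /asm_ent.
  have -> : (F i == j) = false.
    apply/eqP; case: (eqVneq (i : nat) r) => [->|ir].
      by rewrite /F spread_out; lia.
    case: (leqP (g i) o) => [go|og].
      by rewrite /F spread_out; lia.
    have : g i <> g w by apply: perm_neq; lia.
    case: (leqP (g i) (o + e)) => [ge|eg]; last by rewrite /F spread_out; lia.
    have [||] := @spread_in e i; try lia.
    by rewrite -/F => ? _ _; have := maxL i; lia.
  lia.
- move=> i j ri lj; rewrite mxE /asm_ent.
  have -> : (F i == j) = false.
    (* Column [l] is missed by [F] or, before the first move, has its only [1] in row [k], above the
       rectangle. *)
    apply/eqP => Fi; have Fl : F i <> l.
      case: Fvalid => [[l_o FE]|[s V]]; last exact: (v_c V).
      by rewrite FE // l_o -gk; apply: perm_neq; lia.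
    case: (leqP (g i) o) => [go|og].
      have : g i <> o by rewrite -gk; apply: perm_neq; lia.
      by move: Fi; rewrite /F spread_out; lia.
    case: (eqVneq (i : nat) w) => [iw|iw]; first by move: Fi; rewrite iw Fw; lia.
    have : g i <> g w by apply: perm_neq; lia.
    case: (leqP (g i) (o + e)) => [ge|eg]; last by move: Fi; rewrite /F spread_out; lia.
    have [||] := @spread_in e i; try lia.
    by rewrite -/F => ? _ _; have := maxL i; lia.
  lia.
Qed.

End Spread.

(** The last move can be recognised and undone: the row that received the previous closing column
    is, among those below [r], the one with the largest entry in the interval from [o] to [l.-1]. *)
Lemma spread_onto n k r o e f l : k < r < n -> o <= l <= o + e -> f k = o -> f r < o ->
  (l = o /\ permutes n f) \/ (exists s, valid n f k r s o l) ->
  (forall i, r < i < n -> l < f i -> o + e < f i) ->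
  exists g, [/\ permutes n g, forall i, i <= r -> g i = f i,
    forall i, i < n -> (spread n g r o e).1 i = f i & (spread n g r o e).2 = l].
Proof.
elim: e f l => [|e IH] f l kr ol fk fr Hf maxl.
  case: Hf => [[l_o permf]|[s [_ _ _ _ _ _ oc]]]; last by lia.
  by exists f; split.
case: (eqVneq l (o + e.+1)) => [el|nel]; last first.
  have ol' : o <= l <= o + e by lia.
  have maxl' i : r < i < n -> l < f i -> o + e < f i by move=> ri; have := maxl i ri; lia.
  have [g [permg top Fg Lg]] := IH f l kr ol' fk fr Hf maxl'.
  have gk : g k = o by rewrite top //; lia.
  have gr : g r < o by rewrite top.
  have [hkr rn] : k < r /\ r < n by lia.
  exists g; split=> //.
  - case: (spread_stepP r o permg e) => [w F rw gw _|_ i lt_in]; last exact: Fg.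
    move: (maxl w rw); rewrite -Fg; last by lia.
    by rewrite (spread_out permg hkr rn gk gr) ?gw; lia.
  - case: (spread_stepP r o permg e) => [w F rw gw _|//].
    move: (maxl w rw); rewrite -Fg; last by lia.
    by rewrite (spread_out permg hkr rn gk gr) ?gw; lia.
case: Hf => [[l_o _]|[s V]]; first by lia.
case: (V) => _ rs sn _ fs _ oc cn bd fc finj.
pose P x := has (fun i => (r < i) && (f i == x)) (iota 0 n) && (o <= x < l).
have exP : exists x, P x.
  exists o; rewrite /P leqnn oc !andbT; apply/hasP; exists s.
    by rewrite mem_iota sn.
  by rewrite rs fs eqxx.
have leP x : P x -> x <= l by case/andP; lia.
have [x /andP[/hasP[w]] ] := ex_maxnP exP leP.
rewrite mem_iota => /andP[_ lt_wn] /andP[rw /eqP fw] ox maxx.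
pose f' i := if i == w then l else f i.
have f'w i : i <> w -> f' i = f i by rewrite /f' => /eqP/negPf ->.
have xmax i : r < i < n -> f i < l -> o <= f i -> f i <= x.
  move=> ri fl of_; apply: maxx; rewrite /P fl of_ !andbT; apply/hasP; exists i.
    by rewrite mem_iota; lia.
  by rewrite eqxx andbT; lia.
have f'_inj i j : i < n -> j < n -> i <> w -> j <> w -> f' i = f' j -> 
    [\/ i = j, i = k /\ j = s | i = s /\ j = k].
  by move=> lt_in lt_jn iw jw; rewrite !f'w //; apply: finj.
have Hf' : (x = o /\ permutes n f') \/ (exists s, valid n f' k r s o x).
  (* If the largest such column is [o], a single move was made, and undoing it removes the [-1]. *)
  case: (eqVneq x o) => [xo|xo]; [left|right].
    have ws : w = s by case: (finj w k); rewrite ?fw ?xo //; lia.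
    split=> //; split=> [i lt_in|i j lt_in lt_jn].
      by rewrite /f'; case: eqP => // _; apply: bd.
    rewrite /f'; case: eqP => [->|iw]; case: eqP => [->|jw] //.
    - by move=> e'; case: (fc j lt_jn).
    - by move=> e'; case: (fc i lt_in).
    - by case/finj => //; lia.
  have ws : s <> w by move=> e'; move: fs; rewrite e' fw; lia.
  exists s; split; rewrite ?f'w //; try lia.
  - by move=> i lt_in; rewrite /f'; case: eqP => // _; apply: bd.
  - move=> i lt_in; rewrite /f'; case: eqP => [_|iw fix_]; first by lia.
    by case: (finj i w); rewrite ?fix_ //; lia.
  move=> i j lt_in lt_jn; rewrite /f'; case: eqP => [->|iw]; case: eqP => [->|jw].
  - by constructor 1.
  - by move=> e'; case: (fc j lt_jn).
  - by move=> e'; case: (fc i lt_in).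
  - exact: finj.
have ox' : o <= x <= o + e by lia.
have f'k : f' k = o by rewrite f'w //; lia.
have f'r : f' r < o by rewrite f'w //; lia.
have maxx' i : r < i < n -> x < f' i -> o + e < f' i.
  move=> ri; rewrite /f'; case: eqP => [_|iw]; first by lia.
  by have := xmax i ri; have := maxl i ri; have := fc i; lia.
have [g [permg top Fg Lg]] := IH f' x kr ox' f'k f'r Hf' maxx'.
have topf i : i <= r -> g i = f i by move=> ir; rewrite top // f'w //; lia.
have gk : g k = o by rewrite topf //; lia.
have gr : g r < o by rewrite topf.
have [hkr rn] : k < r /\ r < n by lia.
have gw : g w = o + e.+1.
  have := Fg w lt_wn; rewrite /f' eqxx el.
  case: (leqP (g w) o) => [go|og]; first by rewrite (spread_out permg hkr rn gk gr); lia.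
  case: (leqP (g w) (o + e)) => [ge|eg]; last by rewrite (spread_out permg hkr rn gk gr); lia.
  by have [||] := @spread_in n g r o k permg hkr rn gk gr e w; lia.
exists g; split=> //.
- case: (spread_stepP r o permg e) => [w' F rw' gw' fE i lt_in|]; last first.
    by move=> /(_ w); rewrite gw; lia.
  have ew : w' = w by apply: (perm_inj permg); lia.
  rewrite ew in fE.
  by rewrite /= fE // Lg Fg // /f'; case: eqP => // ->.
- case: (spread_stepP r o permg e) => [w' F _ _ _|]; first by rewrite el.
  by move=> /(_ w); rewrite gw; lia.
Qed.

(** * The discharging procedure *)

Lemma filter_iota_nil (p : pred nat) a b : (forall x, a <= x < b -> ~~ p x) ->
  [seq x <- iota a (b - a) | p x] = [::].
Proof.
move=> p0; rewrite (eq_in_filter (a2 := pred0)) ?filter_pred0 // => x.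
by rewrite mem_iota => ltx; apply: negPf; apply: p0; lia.
Qed.

Lemma filter_iota_consecutive (p : pred nat) n x y : p x -> x < y <= n ->
  (forall z, x < z < y -> ~~ p z) ->
  [seq z <- iota 0 n | p z] =
  [seq z <- iota 0 x | p z] ++ x :: [seq z <- iota y (n - y) | p z].
Proof.
move=> px xy none; rewrite (iota_splitS (j := x)); last by lia.
rewrite filter_cat /= px; congr (_ ++ _ :: _).
have -> : n - x.+1 = (y - x.+1) + (n - y) by lia.
by rewrite iotaD filter_cat filter_iota_nil // subnKC //; lia.
Qed.

(** * Entries of the displaced blocks *)

Section Displacements.

Variables (m q : nat) (P : nat -> nat -> int).
Let nzcol j := has (fun i => P i j != 0%R) (iota 0 m).
Let nzrow i := has (fun j => P i j != 0%R) (iota 0 q).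

Lemma Hdisp_next i p j : nzcol p -> p < j < q -> ~~ nzcol q.-1 ->
  nzcol j \/ j = q.-1 -> (forall x, p < x < j -> ~~ nzcol x) ->
  Hdisp m q P i j = P i p.
Proof.
move=> nzp pj nz1 Hj none; rewrite /Hdisp -/nzcol.
rewrite (@filter_iota_consecutive _ _ p j) //; last by lia.
set pre := [seq _ <- iota 0 p | _].
have [rest Erest] : exists rest, rcons [seq z <- iota j (q - j) | nzcol z] q.-1 = j :: rest.
  have -> : q - j = (q - j.+1).+1 by lia.
  case: (boolP (nzcol j)) => [nzj|zj] /=; first by rewrite nzj; eexists.
  case: Hj => [nzj|ej]; first by rewrite nzj in zj.
  rewrite (negPf zj) (_ : q - j.+1 = 0) /=; last by lia.
  by rewrite -ej; exists [::].
(* Targets are the sources shifted by one: dropping the head of [rcons pre p] puts [j] at index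
   [size pre], where the list of sources has [p]. *)
have -> : rcons (behead (pre ++ p :: [seq z <- iota j (q - j) | nzcol z])) q.-1 =
    behead (rcons pre p) ++ j :: rest.
  by rewrite -Erest; case: (pre) => [|x l] //=; rewrite rcons_cat cat_rcons.
have jpre : j \notin behead (rcons pre p).
  apply/negP => /mem_behead; rewrite mem_rcons inE mem_filter mem_iota; lia.
have -> : index j (behead (rcons pre p) ++ j :: rest) = size pre.
  by rewrite index_cat (negPf jpre) /= eqxx addn0 size_behead size_rcons.
rewrite ifT; first by rewrite nth_cat ltnn subnn.
by rewrite size_cat size_behead size_rcons /= addnS ltnS leq_addr.
Qed.

Lemma Hdisp_out i j : nzcol 0 -> j < q -> (j == 0) && (0 < q.-1) || ~~ nzcol j && (j != q.-1) ->
  Hdisp m q P i j = 0%R.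
Proof.
move=> nz0 jq out; rewrite /Hdisp -/nzcol index_mem ifF //.
rewrite (iota_splitS (j := 0)) /=; last by lia.
rewrite nz0 /= mem_rcons inE mem_filter mem_iota; lia.
Qed.

Lemma Vdisp_next p p' j : ~~ nzrow 0 -> nzrow p' -> p < p' < m -> p = 0 \/ nzrow p ->
  (forall x, p < x < p' -> ~~ nzrow x) ->
  Vdisp m q P p j = P p' j.
Proof.
move=> z0 nzp' pp' Hp none; rewrite /Vdisp -/nzrow.
have Ep' : [seq z <- iota p' (m - p') | nzrow z] =
    p' :: [seq z <- iota p'.+1 (m - p'.+1) | nzrow z].
  by rewrite -subnSK /= ?nzp' //; lia.
(* Row [0] is a target although it is a zero row: it is the one put in front of the list. *)
case: Hp => [p0|nzp].
  have -> : [seq z <- iota 0 m | nzrow z] = [seq z <- iota p' (m - p') | nzrow z].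
    have -> : iota 0 m = iota 0 p' ++ iota p' (m - p').
      by have := iotaD 0 p' (m - p'); rewrite subnKC //; move: pp'; lia.
    rewrite filter_cat -{1}[p']subn0 filter_iota_nil // => x x0.
    by case: (posnP x) => [->|x_gt0]; [|apply: none; lia].
  by rewrite Ep' p0.
rewrite (@filter_iota_consecutive _ _ p p') //; last by lia.
have p_gt0 : 0 < p by case: (posnP p) nzp z0 => // -> ->.
set pre := [seq _ <- iota 0 p | _]; rewrite Ep'; set rest := [seq _ <- _ | _].
have pre0 : p \notin 0 :: pre by rewrite inE mem_filter mem_iota; lia.
have -> : 0 :: pre ++ p :: p' :: rest = (0 :: rcons pre p) ++ p' :: rest by rewrite /= cat_rcons.
have Esz : (size (pre ++ [:: p, p' & rest]) < size (0 :: rcons pre p)) = false.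
  by rewrite size_cat /= size_rcons; lia.
rewrite take_cat Esz.
rewrite -rcons_cons index_cat mem_rcons mem_head -cats1 index_cat (negPf pre0) /= eqxx addn0.
rewrite size_cat /= size_cat /= ifT; last by lia.
by rewrite nth_cat ltnNge leqnSn /= subSnn.
Qed.

Lemma Vdisp_out p j : p != 0 -> ~~ nzrow p || (p == m.-1) && nzrow p ->
  Vdisp m q P p j = 0%R.
Proof.
move=> p0 out; rewrite /Vdisp -/nzrow index_mem ifF //.
apply/negP; set rs := filter _ _; have {rs}-> : rs = [seq z <- iota 0 m | nzrow z] by [].
set rs := [seq _ <- _ | _].
(* A nonzero last row is a source only: [take] drops it from the targets. *)
case: (boolP (nzrow p)) out => [nzp /= /andP[/eqP pm _]|zp _]; last first.
  by move/mem_take; rewrite inE (negPf p0) mem_filter => /andP[/(negP zp)].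
have -> : rs = rcons [seq z <- iota 0 p | nzrow z] p.
  rewrite /rs (_ : m = p + 1); last by lia.
  by rewrite iotaD filter_cat /= add0n nzp cats1.
rewrite size_rcons /= -cats1 take_size_cat // inE (negPf p0) mem_filter mem_iota; lia.
Qed.

End Displacements.

(** * Parameters of a matrix rebuilt from its discharged permutation *)

Section Discharge.

Variables (n : nat) (g0 : nat -> nat) (k d e : nat).
Let o := g0 k.
Let r := k + d.+1.
Let g := climb g0 k d.
Let f := (spread n g r o e).1.
Let c := (spread n g r o e).2.
Let A := asm n f r o c.
Hypotheses (permg0 : permutes n g0) (rn : r < n) (left1 : g0 k.+1 < o) (oc : o < c) (ce : c = o + e).

Let kr : k < r. Proof. by rewrite /r; lia. Qed.
Let permg : permutes n g.
Proof. exact (climb_perm permg0 rn). Qed.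
Let gk : g k = o. Proof. by rewrite /g climb_out ?leqnn. Qed.
Let gr : g r < o. Proof. exact: (climb_last permg0). Qed.

Lemma discharge_valid : exists s, valid n f k r s o c.
Proof.
case: (spread_valid permg kr rn gk gr e) => [[eo _]|//].
by move: oc; rewrite /c eo ltnn.
Qed.

Lemma spread_next i : r < i < n -> o < g i <= c ->
  [/\ o <= f i < g i,
      forall x, f i < x < g i -> forall i', r < i' < n -> f i' <> x &
      g i <> c -> exists2 i', r < i' < n & f i' = g i].
Proof.
move=> ri gi; have gi' : o < g i <= o + e by rewrite -ce.
have [] := spread_in permg kr rn gk gr ri gi'; rewrite -/f => fi next low.
split=> // [x fx i' ri' fi'|gic].
  have lowx : exists2 i'', r < i'' < n & g i'' = x.
    case: (leqP (g i') o) => [go|og].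
      by exists i' => //; rewrite -fi' /f (spread_out permg kr rn gk gr) //; lia.
    case: (leqP (g i') (o + e)) => [ge|eg].
      have ogi' : o < g i' <= o + e by rewrite og.
      have [_ _ [|//]] := spread_in permg kr rn gk gr ri' ogi'; rewrite -/f fi' //; lia.
    by exists i' => //; rewrite -fi' /f (spread_out permg kr rn gk gr) //; lia.
  by case: lowx => i'' ri'' gx; have := next i'' ri''; lia.
apply: (spread_cover permg kr rn gk gr); first by rewrite -/c; lia.
by right; exists i.
Qed.

Lemma spread_not_low j : o < j < c -> (forall i, r < i < n -> g i <> j) ->
  forall i, r < i < n -> f i <> j.
Proof.
move=> oj high i ri fi.
case: (leqP (g i) o) => [go|og].
  by move: fi; rewrite /f (spread_out permg kr rn gk gr); lia.
case: (leqP (g i) c) => [ge|eg].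
  have og' : o < g i <= o + e by lia.
  have [_ _] := spread_in permg kr rn gk gr ri og'; rewrite -/f fi.
  case=> [|[i' ri' gi']]; first by lia.
  by case: (high i' ri').
by have := high i ri; move: fi; rewrite /f (spread_out permg kr rn gk gr); lia.
Qed.

(** The construction is taken apart in reverse order: deleting the two entries of row [r] leaves
    [f], the displacement [H] turns [f] into [g], and [V] with the lowering turns [g] into [g0]. *)
Lemma delta_discharge : delta A = perm_mat n g0.
Proof.
have [s V] := discharge_valid; case: (V) => _ rs sn fk fs fro _ cn bd fc finj.
apply/matrixP=> i0 j0; rewrite !mxE.
move: (ltn_ord i0) (ltn_ord j0); move: (nat_of_ord i0) (nat_of_ord j0) => i j lt_in lt_jn {i0 j0}.
pose F1 i j := if (i == r) && ((j == o) || (j == c)) then 0%R else ent A i j.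
pose H2 := Hdisp (n - r.+1) (c - o).+1 (fun i j => F1 (r.+1 + i) (o + j)).
pose F2 i j := if (r < i) && (o <= j <= c) then H2 (i - r.+1) (j - o) else F1 i j.
pose V3 := Vdisp (r - k).+1 o (fun i j => F2 (k + i) j).
pose F3 i j := if (k <= i <= r) && (j < o) then V3 (i - k) j else F2 i j.
transitivity (if j < o then
    (if k < i <= r then F3 i.-1 j else if i == k then 0%R else F3 i j)
  else if o < j then
    (if k.+1 < i <= r then F3 i.-1 j else if i == k.+1 then 0%R else F3 i j)
  else F3 i j).
  by rewrite /delta_fun (asm_orow V) (asm_crow V) (asm_ocol V) (asm_ccol V).
have F1E i' j' : i' < n -> j' < n -> F1 i' j' = (f i' == j')%:Z.
  move=> lt_i lt_j; rewrite /F1 (asm_entE f r o c) // /asm_ent.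
  by case: (eqVneq i' r) => [->|ne] /=; [do ![case: eqP => ? /=]; lia | rewrite subr0 addr0].
have H2E i' j' : r < i' < n -> o <= j' <= c -> H2 (i' - r.+1) (j' - o) = (g i' == j')%:Z.
  move=> ri oj.
  pose Q i j := F1 (r.+1 + i) (o + j).
  have nzE x : x <= c - o -> has (fun i => Q i x != 0%R) (iota 0 (n - r.+1)) ->
      exists2 i, r < i < n & f i = o + x.
    move=> xc /hasP[y]; rewrite mem_iota /Q => yn; rewrite F1E; try lia.
    by case: eqP => // fx _; exists (r.+1 + y) => //; lia.
  have nzI x i1 : x <= c - o -> r < i1 < n -> f i1 = o + x ->
      has (fun i => Q i x != 0%R) (iota 0 (n - r.+1)).
    move=> xc ri1 fi1; apply/hasP; exists (i1 - r.+1); first by rewrite mem_iota; lia.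
    by rewrite /Q subnKC; [rewrite F1E ?fi1 ?eqxx //; lia | lia].
  have nz0 : has (fun i => Q i 0 != 0%R) (iota 0 (n - r.+1)).
    by apply: (nzI _ s); rewrite ?addn0 //; lia.
  have nz1 : ~~ has (fun i => Q i (c - o) != 0%R) (iota 0 (n - r.+1)).
    by apply/negP => /nzE-/(_ (leqnn _))[i1 ri1]; have := fc i1; lia.
  rewrite /H2 -/Q; case: (eqVneq j' o) => [->|jo].
    rewrite Hdisp_out ?subnn //; last by lia.
    case: eqP => // gi; have := @perm_inj n g permg i' k; lia.
  case: (boolP (has (fun i => (r < i) && (g i == j')) (iota 0 n))) => [/hasP[i1]|/hasPn high].
    rewrite mem_iota => lti1 /andP[ri1 /eqP gi1].
    have ri1' : r < i1 < n by lia.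
    have [|fi1 none nzj] := spread_next ri1'; first by rewrite gi1; lia.
    rewrite (@Hdisp_next _ _ _ _ (f i1 - o)) /=.
    - rewrite /Q !subnKC; try lia.
      rewrite F1E; try lia.
      congr (nat_of_bool _)%:Z; apply/eqP/eqP=> [|gi]; last first.
        by congr (f _); apply: (perm_inj permg); lia.
      by move=> eqf; rewrite -gi1; congr (g _); case: (finj i' i1); lia.
    - by apply: (nzI _ i1) => //; lia.
    - by lia.
    - exact: nz1.
    - case: (eqVneq j' c) => [->|jc]; [by right | left].
      have [|i2 ri2 fi2] := nzj; first by rewrite gi1; apply/eqP.
      by apply: (nzI _ i2) => //; lia.
    - move=> x fx; apply/negP => /nzE[|i2 ri2 fi2]; first by lia.
      by apply: (none (o + x) _ i2 ri2) => //; lia.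
  have jc : j' <> c.
    move=> ejc; case: (spread_last_low r o permg e) => [|[i1 ri1 gi1]]; first by rewrite -/c; lia.
    by have := high i1; rewrite mem_iota gi1 -/c ejc eqxx; lia.
  have high' i1 : r < i1 < n -> g i1 <> j'.
    by move=> ri1 gi1; have := high i1; rewrite mem_iota gi1 eqxx; lia.
  rewrite Hdisp_out ?nz0 //=; [|lia|].
    by case: eqP => // gi; case: (high' i').
  apply/orP; right; apply/andP; split; last by lia.
  apply/negP => /nzE[|i1 ri1]; first by lia.
  by rewrite subnKC; [apply: spread_not_low high' _ ri1; lia | lia].
have F2E i' j' : i' < n -> j' < n -> F2 i' j' = (g i' == j')%:Z.
  move=> lt_i lt_j; rewrite /F2; case: ifP => [ri|out]; first by rewrite H2E; lia.
  rewrite F1E //; congr (nat_of_bool _)%:Z.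
  case: (leqP (g i') o) => [go|og]; first by rewrite /f (spread_out permg kr rn gk gr) //; lia.
  case: (leqP i' r) => [ir|ri]; first by rewrite /f (spread_out permg kr rn gk gr) //; lia.
  case: (leqP (g i') c) => [ge|eg].
    have og' : o < g i' <= o + e by lia.
    have ri' : r < i' < n by lia.
    by have [] := spread_in permg kr rn gk gr ri' og'; rewrite -/f; lia.
  by rewrite /f (spread_out permg kr rn gk gr) //; lia.
(* After [V], the left part of row [i'] is that of row [i'.+1] of [g0]; the lowering then only
   shifts the index. *)
have V3E i' j' : k <= i' < r -> j' < o -> V3 (i' - k) j' = (g0 i'.+1 == j')%:Z.
  move=> ki jo; pose Q i j := F2 (k + i) j.
  have nzE x : x <= r - k -> has (fun j => Q x j != 0%R) (iota 0 o) = (g (k + x) < o).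
    move=> xr; apply/hasP/idP => [[y]|gx].
      rewrite mem_iota /Q => yo; rewrite F2E; lia.
    exists (g (k + x)); first by rewrite mem_iota.
    by rewrite /Q F2E ?eqxx //; lia.
  have gk' : ~~ has (fun j => Q 0 j != 0%R) (iota 0 o).
    by rewrite nzE ?addn0 ?gk ?ltnn.
  rewrite /V3 -/Q; case: (boolP ((i' == k) || (g i' < o))) => [lefti|].
    (* The next left row after [i']; the closing row shows that there is one. *)
    have exq : exists q, (i' < q <= r) && (g q < o) by exists r; rewrite gr; lia.
    have [q /andP[iq gq] minq] := ex_minnP exq.
    have btw x : i' < x < q -> o <= g x.
      by move=> ix; have := minq x; lia.
    rewrite (@Vdisp_next _ _ _ _ (q - k)) //.
    - rewrite /Q subnKC; last by lia.
      rewrite F2E; [|lia|lia]; congr (nat_of_bool _)%:Z; congr (_ == _).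
      have Hl : i' = k \/ g i' < o by case: eqP lefti => [|_]; [left | right].
      apply: (climb_next permg0 left1) Hl gq _ => //; try lia.
      move=> x ix; have := btw x ix; have := @climb_neq n g0 k permg0 left1 d x rn.
      by rewrite -/g -/o; lia.
    - by rewrite nzE ?subnKC; lia.
    - lia.
    - case: (eqVneq i' k) lefti => [->|ik] /= gi; first by left; rewrite subnn.
      by right; rewrite nzE ?subnKC; lia.
    - by move=> x ix; rewrite nzE; [have := btw (k + x)|]; lia.
  rewrite negb_or => /andP[ik gi]; rewrite Vdisp_out; [|lia|].
    case: eqP => // gi1.
    have := @climb_left n g0 k permg0 left1 d i' rn.
    by rewrite -/g -/r -/o; lia.
  by rewrite nzE ?subnKC; lia.
have out i' : i' < n -> (i' <= k) || (r < i') -> g i' = g0 i'.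
  by move=> lt_i ki; rewrite /g climb_out.
case: (ltngtP j o) => [jo|oj|->].
- case: ifP => [ki|/negbT ki].
    rewrite /F3 ifT; last by lia.
    by rewrite V3E //; [rewrite prednK //; lia | lia].
  case: eqP => [->|ik]; first by rewrite -/o; lia.
  by rewrite /F3 ifF ?F2E ?out //; lia.
- rewrite /F3; case: ifP => [ki|/negbT ki].
    rewrite ifF; last by lia.
    rewrite F2E; [|lia|lia]; congr (nat_of_bool _)%:Z.
    case: (ltnP o (g0 i)) => [oi|io].
      by congr (_ == _); rewrite /g (climb_right left1 rn) ?prednK -/o -/r //; lia.
    have := @climb_left n g0 k permg0 left1 d i.-1 rn.
    by rewrite prednK -/g -/r -/o; lia.
  case: eqP => [->|ik]; first by have := left1; lia.
  by rewrite ifF ?F2E ?out //; lia.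
- rewrite /F3 ifF ?F2E //; [|lia|lia].
  have [? inj0] := permg0; congr (nat_of_bool _)%:Z; apply/eqP/eqP => ei.
    by have -> // : i = k by apply: (perm_inj permg); lia.
  by have -> : i = k by apply: inj0; lia.
Qed.

Let V : exists s, valid n f k r s o c := discharge_valid.

(** [climb] changes no row up to [k], and over all rows both permutations meet each column between
    [v] and [o] exactly once. *)
Lemma count_left_climb v :
  count (fun i => (k < i) && (v < g i < o)) (iota 0 n) =
  count (fun i => (k < i) && (v < g0 i < o)) (iota 0 n).
Proof.
have split (h : nat -> nat) : permutes n h ->
    count (fun i => (i <= k) && (v < h i < o)) (iota 0 n)
    + count (fun i => (k < i) && (v < h i < o)) (iota 0 n)
    = count (fun x => v < x < o) (iota 0 n).
  move=> permh; rewrite -(count_perm (fun x => v < x < o) permh) -count_predUI addnC.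
  rewrite [X in X + _](_ : _ = 0) ?add0n.
    by apply: eq_count => i /=; case: (leqP i k); rewrite /= ?orbF.
  by apply/eqP; rewrite -leqn0 leqNgt -has_count; apply/hasPn => i _ /=; lia.
apply/eqP; rewrite -(eqn_add2l (count (fun i => (i <= k) && (v < g0 i < o)) (iota 0 n))).
rewrite split // -(split g) // eqn_add2r; apply/eqP/eq_count_iota => i _.
by case: (leqP i k) => //= ik; rewrite /g climb_out ?ik.
Qed.

Lemma spread_lt i : i < n -> (f i < o) = (g i < o).
Proof.
move=> lt_in; case: (leqP (g i) o) => [go|og].
  by rewrite /f (spread_out permg kr rn gk gr) // go orbT.
case: (leqP i r) => [ir|ri].
  by rewrite /f (spread_out permg kr rn gk gr) ?ir //; lia.
case: (leqP (g i) c) => [gc|cg]; last first.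
  by rewrite /f (spread_out permg kr rn gk gr) -?ce ?cg ?orbT //; lia.
have ri' : r < i < n by lia.
have og' : o < g i <= c by lia.
by have [] := spread_next ri' og'; rewrite -/f; lia.
Qed.

Lemma spread_eq i : i < n -> g i <= o -> f i = g i.
Proof. by move=> lt_in go; rewrite /f (spread_out permg kr rn gk gr) // go orbT. Qed.

Lemma spread_top i : i <= r -> f i = g i.
Proof. by move=> ir; rewrite /f (spread_out permg kr rn gk gr) ?ir //; lia. Qed.

Lemma discharge_in_A1 : in_A1 A.
Proof. by have [s Vs] := V; apply: asm_in_A1 Vs. Qed.

Lemma discharge_orow : orow A = k.
Proof. by have [s Vs] := V; apply: asm_orow Vs. Qed.

Lemma discharge_neutral : neutral A = (d == 0).
Proof. by have [s Vs] := V; rewrite (asm_neutral Vs) /r; lia. Qed.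

Lemma discharge_positive : positive A = (0 < d) && (o < g0 r).
Proof.
have [s Vs] := V; rewrite (asm_positive Vs) (_ : (k.+1 < r) = (0 < d)); last by rewrite /r; lia.
case: posnP => //= d_gt0; rewrite spread_top ?leq_pred //.
have kd : k < k + d < k + d.+1 by lia.
have -> : r.-1 = k + d by rewrite /r; lia.
have Er : r = (k + d).+1 by rewrite /r; lia.
rewrite Er; case: (ltnP o (g0 (k + d).+1)) => [oi|io].
  by rewrite /g (climb_right left1 rn kd oi) oi.
by have := climb_left permg0 left1 rn kd io; rewrite -/g -/o; lia.
Qed.

Lemma discharge_top (i j : 'I_n) : i <= k -> A i j = (g0 i == j :> nat)%:Z.
Proof.
move=> ik; rewrite mxE /asm_ent spread_top; last by move: kr; lia.
rewrite /g climb_out ?ik //; move: kr; lia.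
Qed.

Lemma discharge_charge :
  charge A = (count (fun i => (k.+1 < i <= r) && (o < g0 i)) (iota 0 n))%:Z.
Proof.
have [s Vs] := V; rewrite (asm_charge Vs) -(count_climb permg0 left1 rn); congr Posz.
apply: eq_count_iota => i lt_in; case: (boolP (k < i < r)) => //= ki.
by rewrite spread_top //; lia.
Qed.

(** By [climb_next] with [p = k], the first left entry below row [k] is [g0 k.+1]. So the leading
    column, and by [count_left_climb] the whole of [ell], is independent of [d] and of the closing
    column. *)
Lemma discharge_ell :
  ell A = (count (fun i => (k < i) && (g0 k.+1 < g0 i < o)) (iota 0 n))%:Z.
Proof.
have [s Vs] := V.
have exq : exists q, (k < q <= r) && (g q < o) by exists r; rewrite gr kr leqnn.
have [q /andP[kq gq] minq] := ex_minnP exq.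
have btw i : k < i < q -> o < g i.
  move=> ki; have := minq i; have := @climb_neq n g0 k permg0 left1 d i rn.
  by rewrite -/g -/o; move: rn; lia.
have fq : f q = g0 k.+1.
  rewrite spread_top; last by lia.
  by apply: (climb_next permg0 left1 rn) _ _ gq btw; [lia|lia|left].
rewrite (asm_ell Vs kq) ?fq //; first last.
  by move=> i ki; rewrite spread_top ?btw //; lia.
rewrite -count_left_climb; congr Posz; apply: eq_count_iota => i lt_in.
have := spread_lt lt_in; have := @spread_eq i lt_in; lia.
Qed.

Lemma discharge_count_low :
  (count (fun i => (r < i) && (o < g i <= c)) (iota 0 n)) =
  (count (fun i => (r < i) && (o < g0 i < c)) (iota 0 n)).+1.
Proof.
have [lo|[i1 ri1 gi1]] := spread_last_low r o permg e.
  by move: oc; rewrite /c lo ltnn.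
rewrite -/c in gi1.
have c_out i : r < i -> g i = g0 i by move=> ri; rewrite /g climb_out ?ri ?orbT.
apply: (@count_add1 _ _ _ i1); first by lia.
  by rewrite -c_out ?gi1 -/c; lia.
move=> i lt_in; case: (eqVneq i i1) => [->|ne]; first by rewrite gi1 -/c; move: oc; lia.
have : g i <> c by rewrite -gi1; apply: (perm_neq permg); lia.
by case: (leqP i r) => //= ri; rewrite c_out //; lia.
Qed.

(** The two counts of [count_spread] each contain one row outside the closing cell: row [s], with
    its entry in column [o], on the side of [f], and the row of column [c] on the side of [g]. *)
Lemma discharge_cpar :
  cpar A = (count (fun i => (r < i) && (o < g0 i < c)) (iota 0 n))%:Z.
Proof.
have [s Vs] := V; rewrite (asm_cpar Vs); congr Posz; apply: succn_inj.
rewrite -discharge_count_low -(count_spread permg kr rn gk gr); symmetry.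
case: Vs => _ rs sn fk fs fro _ cn bd fc finj.
apply: (@count_add1 _ _ _ s) => //; first by rewrite fs ltnn andbF.
move=> i lt_in; case: (eqVneq i s) => [->|ne]; first by rewrite -/f -/c fs; lia.
have : r < i -> f i <> o by move=> ri fi; case: (finj i s); rewrite ?fi //; lia.
by rewrite -/f -/c; case: (leqP i r) => //= ri; lia.
Qed.

(** [charge A] is the number of row exchanges and [cpar A + 1] that of column moves, the last of
    which reaches [c] itself. *)
Lemma discharge_inversions :
  inversions A = (inversions (perm_mat n g0) + charge A + cpar A + 1)%R.
Proof.
rewrite /A (inversions_spread permg kr rn gk gr) discharge_count_low -/A.
rewrite (inversions_climb permg0 left1 rn) discharge_charge discharge_cpar.
by rewrite intS (addrC 1%R) !addrA.
Qed.

End Discharge.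

Lemma discharge_onto n (A : 'M[int]_n) : in_PN A ->
  exists g0 k d e, [/\ [/\ permutes n g0, k + d.+1 < n, g0 k.+1 < g0 k & d = 0 \/ g0 k < g0 (k + d.+1)],
    g0 k < (spread n (climb g0 k d) (k + d.+1) (g0 k) e).2,
    (spread n (climb g0 k d) (k + d.+1) (g0 k) e).2 = g0 k + e &
    A = asm n (spread n (climb g0 k d) (k + d.+1) (g0 k) e).1 (k + d.+1) (g0 k)
          (spread n (climb g0 k d) (k + d.+1) (g0 k) e).2].
Proof.
case/andP=> /in_A1_valid[f [k [r [s [o [c [V ->]]]]]]].
rewrite (asm_positive V) (asm_neutral V) => posneu.
case: (V) => kr rs sn fk fs fro oc cn bd fc finj.
have kr' : k < r < n by lia.
have oc' : o <= c <= o + (c - o) by lia.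
have maxc i : r < i < n -> c < f i -> o + (c - o) < f i by lia.
have [g [permg top Fg Lg]] := spread_onto kr' oc' fk fro (or_intror (ex_intro _ s V)) maxc.
pose d := r - k.+1; have Er : r = k + d.+1 by rewrite /d; lia.
have gr : g (k + d.+1) < g k by rewrite -Er !top // ?fk //; lia.
have rn : k + d.+1 < n by lia.
have [g0 [perm0 left0 top0 eqg]] := climb_onto permg rn gr.
have g0k : g0 k = o by rewrite top0 // top //; lia.
exists g0, k, d, (c - o); rewrite g0k -Er.
have Esp i : (spread n (climb g0 k d) r o (c - o)).2 = (spread n g r o (c - o)).2 /\
    (spread n (climb g0 k d) r o (c - o)).1 i = (spread n g r o (c - o)).1 i.
  elim: (c - o) i => [|e IH] i /=; first by rewrite eqg.
  have -> : has (fun i => (r < i) && (climb g0 k d i == o + e.+1)) (iota 0 n) =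
            has (fun i => (r < i) && (g i == o + e.+1)) (iota 0 n).
    by apply: eq_has => i'; rewrite eqg.
  by case: ifP => _; [rewrite /= eqg (IH i).1 (IH i).2 | apply: IH].
have -> : (spread n (climb g0 k d) r o (c - o)).2 = c by rewrite (Esp 0).1.
split=> //; last 2 first.
- by lia.
- by apply/matrixP=> i j; rewrite !mxE /asm_ent (Esp i).2 Fg.
rewrite -g0k Er; split=> //; case: (posnP d) => [|d_gt0]; [by left|right].
have pos : k.+1 < r by rewrite Er; lia.
have kd : k < k + d < k + d.+1 by lia.
have fr1 : o < f (k + d) by move: posneu; rewrite (_ : r.-1 = k + d); lia.
have : climb g0 k d (k + d) = f (k + d) by rewrite eqg top //; lia.
rewrite ltnNge; apply: contra_eqN => le_o.
have := climb_left perm0 left0 rn kd; rewrite -addnS => /(_ le_o); lia.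
Qed.

(** * Recovering the matrix from its charge and closing parameters *)

(** The conclusion also locates a jump of [h]: this is what singles out a closing row or a closing
    column. *)
Lemma discrete_ivt (h : nat -> nat) a b m : a <= b -> h a <= m < h b ->
  (forall x, h x.+1 <= (h x).+1) ->
  exists2 x, a <= x < b & h x = m /\ h x.+1 = m.+1.
Proof.
move=> ab /andP[ha hb] step.
have exb : exists x, (a <= x) && (m < h x) by exists b; rewrite ab hb.
have [x /andP[ax mx] minx] := ex_minnP exb.
have ltax : a < x.
  by rewrite ltn_neqAle ax andbT; apply: contraTneq mx => <-; rewrite -leqNgt.
have xb : x <= b by apply: minx; rewrite ab hb.
exists x.-1; first by lia.
have := minx x.-1; have := step x.-1; rewrite prednK; lia.
Qed.

Lemma count_lt n (p q : pred nat) w : w < n -> ~~ p w -> q w ->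
  (forall i, i < n -> p i -> q i) -> count p (iota 0 n) < count q (iota 0 n).
Proof.
move=> lt_wn pw qw pq.
rewrite -(@count_add1 n p (fun i => p i || (i == w)) w) //.
have /eq_in_count -> : {in iota 0 n, (fun i => p i || (i == w)) =1
    predI q (fun i => p i || (i == w))}.
  move=> i; rewrite mem_iota => /andP[_ lt_in] /=.
  by case: (boolP (p i)) => [/(pq _ lt_in) ->|_] //=; case: eqP => [->|_]; rewrite ?qw ?andbF.
by apply: sub_count => i /andP[].
Qed.

Lemma count_leS n (p q : pred nat) w : (forall i, i < n -> q i -> p i || (i == w)) ->
  count q (iota 0 n) <= (count p (iota 0 n)).+1.
Proof.
move=> qp; have le1 : count (pred1 w) (iota 0 n) <= 1.
  by rewrite count_uniq_mem ?iota_uniq // leq_b1.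
apply: leq_trans (_ : count (predU p (pred1 w)) (iota 0 n) <= _).
  have /eq_in_count -> : {in iota 0 n, q =1 predI q (predU p (pred1 w))}.
    by move=> i; rewrite mem_iota => /andP[_ lt_in] /=; case: (boolP (q i)) => // /(qp _ lt_in) ->.
  by apply: sub_count => i /andP[].
apply: leq_trans (leq_addr (count (predI p (pred1 w)) (iota 0 n)) _) _; rewrite count_predUI -addn1.
by rewrite leq_add2l.
Qed.

Lemma count_split n (a b c : pred nat) :
  (forall i, i < n -> c i = a i (+) b i) -> (forall i, i < n -> ~~ (a i && b i)) ->
  count c (iota 0 n) = count a (iota 0 n) + count b (iota 0 n).
Proof.
move=> cE disj; rewrite -count_predUI [X in _ + X](_ : _ = 0) ?addn0.
  by apply: eq_count_iota => i lt_in; rewrite cE //=; have := disj i lt_in; case: (a i); case: (b i).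
apply/eqP; rewrite -leqn0 leqNgt -has_count; apply/hasPn => i.
by rewrite mem_iota => /andP[_ lt_in] /=; apply: disj.
Qed.

(* The inverse of the discharging procedure, from the discharged permutation
   [g0], the opening row [k], the closing row [k + d.+1] and the closing
   column [c]. *)
Definition charged n g0 k d c : 'M[int]_n :=
  let fl := spread n (climb g0 k d) (k + d.+1) (g0 k) (c - g0 k) in
  asm n fl.1 (k + d.+1) (g0 k) fl.2.

(** [ch_pos] and [ch_col] place [d] and [c] where the respective counts jump, which makes both
    counts injective. [ch_pos] is also the form taken by the condition that the matrix be neutral or
    positive. *)
Record chargeable n g0 k d c : Prop := Chargeable {
  ch_perm : permutes n g0;
  ch_lt : k + d.+1 < n;
  ch_left : g0 k.+1 < g0 k;
  ch_right : g0 k < c;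
  ch_col : exists2 i, k + d.+1 < i < n & g0 i = c;
  ch_pos : d = 0 \/ g0 k < g0 (k + d.+1) }.

Definition charge_count n (g0 : nat -> nat) k d :=
  count (fun i => (k.+1 < i <= k + d.+1) && (g0 k < g0 i)) (iota 0 n).

Definition closing_count n (g0 : nat -> nat) k d c :=
  count (fun i => (k + d.+1 < i) && (g0 k < g0 i < c)) (iota 0 n).

Definition leading_count n (g0 : nat -> nat) k :=
  count (fun i => (k < i) && (g0 k.+1 < g0 i < g0 k)) (iota 0 n).

Lemma spread_reach n g k r o e : permutes n g -> k < r -> r < n -> g k = o -> g r < o ->
  (exists2 i, r < i < n & g i = o + e) -> (spread n g r o e).2 = o + e.
Proof.
move=> permg kr rn gk gr [i ri gi]; have := spread_last permg kr rn gk gr e.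
have := spread_last_max permg kr rn gk gr (e := e) ri; lia.
Qed.

Lemma charged_last n g0 k d c : chargeable n g0 k d c ->
  (spread n (climb g0 k d) (k + d.+1) (g0 k) (c - g0 k)).2 = c.
Proof.
case=> permg rn left1 oc [i ri gi] _.
have Ec : g0 k + (c - g0 k) = c by lia.
rewrite (@spread_reach _ _ k) //; try lia.
- exact: climb_perm.
- by rewrite climb_out ?leqnn.
- exact: (climb_last permg).
- by exists i => //; rewrite climb_out; lia.
Qed.

Lemma chargedP n g0 k d c (A := charged n g0 k d c) : chargeable n g0 k d c ->
  [/\ [/\ in_A1 A, orow A = k, delta A = perm_mat n g0, neutral A = (d == 0) &
        positive A = (0 < d) && (g0 k < g0 (k + d.+1))],
      charge A = (charge_count n g0 k d)%:Z,
      cpar A = (closing_count n g0 k d c)%:Z,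
      ell A = (leading_count n g0 k)%:Z &
      [/\ (forall i j : 'I_n, i <= k -> A i j = (g0 i == j :> nat)%:Z) &
      inversions A = (inversions (perm_mat n g0) + charge A + cpar A + 1)%R]].
Proof.
move=> H; have Ec := charged_last H.
case: (H) => permg rn left1 oc [i0 ri gi] _.
have ce : (spread n (climb g0 k d) (k + d.+1) (g0 k) (c - g0 k)).2 = g0 k + (c - g0 k).
  by rewrite Ec; lia.
have oc' : g0 k < (spread n (climb g0 k d) (k + d.+1) (g0 k) (c - g0 k)).2 by rewrite Ec.
split; first split.
- exact: discharge_in_A1.
- exact: discharge_orow.
- exact: delta_discharge.
- exact: discharge_neutral.
- exact: discharge_positive.
- exact: discharge_charge.
- by rewrite /closing_count -[in RHS]Ec; apply: discharge_cpar.
- exact: discharge_ell.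
- split; first exact: discharge_top.
  exact: discharge_inversions.
Qed.

Lemma in_PN_charged n (A : 'M[int]_n) : in_PN A ->
  exists g0 k d c, chargeable n g0 k d c /\ A = charged n g0 k d c.
Proof.
case/discharge_onto=> g0 [k [d [e [[permg rn left1 pos] oc ce ->]]]].
exists g0, k, d, (g0 k + e); rewrite /charged addKn; split=> //.
split=> //; first by rewrite -ce.
have kr : k < k + d.+1 by lia.
have permc := climb_perm permg rn.
have gk : climb g0 k d k = g0 k by rewrite climb_out ?leqnn.
case: (spread_last_low (k + d.+1) (g0 k) permc e) => [lo|[i ri gi]].
  by move: oc; rewrite lo ltnn.
by exists i => //; rewrite -ce -gi climb_out //; lia.
Qed.

Lemma charged_ext n g0 g1 k d c : (forall i, i < n -> g0 i = g1 i) -> k + d.+1 < n ->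
  charged n g0 k d c = charged n g1 k d c.
Proof.
move=> eqg rn; have eqk : g0 k = g1 k by apply: eqg; lia.
have eqc d' : k + d'.+1 < n -> forall i, i < n -> climb g0 k d' i = climb g1 k d' i.
  elim: d' => [_|d' IH lt_n] i lt_in /=; first exact: eqg.
  rewrite -eqk -(eqg (k + d'.+1).+1); last by lia.
  by case: ifP => _; rewrite /swap_next ?IH //; lia.
have eqs e : (spread n (climb g0 k d) (k + d.+1) (g0 k) e).2 =
             (spread n (climb g1 k d) (k + d.+1) (g1 k) e).2 /\
    forall i, i < n -> (spread n (climb g0 k d) (k + d.+1) (g0 k) e).1 i =
             (spread n (climb g1 k d) (k + d.+1) (g1 k) e).1 i.
  elim: e => [|e [IH1 IH2]] /=; first by split=> //; exact: eqc.
  rewrite -eqk in IH1 IH2 *.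
  have <- : has (fun i => (k + d.+1 < i) && (climb g0 k d i == g0 k + e.+1)) (iota 0 n) =
         has (fun i => (k + d.+1 < i) && (climb g1 k d i == g0 k + e.+1)) (iota 0 n).
    by apply: eq_in_has => i; rewrite mem_iota => /andP[_ lt_in]; rewrite eqc.
  case: ifP => _ //=; split=> // i lt_in.
  by rewrite eqc // IH1 IH2.
apply/matrixP=> i j; rewrite !mxE -eqk.
have [e1 e2] := eqs (c - g0 k); rewrite -eqk in e1 e2.
by rewrite /asm_ent e1 e2.
Qed.

Lemma perm_mat_inj n g0 g1 : permutes n g0 -> perm_mat n g0 = perm_mat n g1 ->
  forall i, i < n -> g0 i = g1 i.
Proof.
case=> bd _ /matrixP eqm i lt_in; have := eqm (Ordinal lt_in) (Ordinal (bd i lt_in)).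
by rewrite !mxE /= eqxx; case: eqP.
Qed.

Lemma charge_count_inj n g0 k d d' : k + d.+1 < n -> k + d'.+1 < n ->
  d = 0 \/ g0 k < g0 (k + d.+1) -> d' = 0 \/ g0 k < g0 (k + d'.+1) ->
  charge_count n g0 k d = charge_count n g0 k d' -> d = d'.
Proof.
wlog lt_d : d d' / d < d' => [wlog_lt|] lt_n lt_n' pos pos' eq_count.
  by case: (ltngtP d d') => // ?; [|symmetry]; apply: wlog_lt.
have : charge_count n g0 k d < charge_count n g0 k d'; last by rewrite eq_count ltnn.
by apply: (@count_lt _ _ _ (k + d'.+1)); lia.
Qed.

Lemma closing_count_inj n g0 k d c c' : chargeable n g0 k d c -> chargeable n g0 k d c' ->
  closing_count n g0 k d c = closing_count n g0 k d c' -> c = c'.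
Proof.
wlog lt_c : c c' / c < c' => [wlog_lt|] H H' eq_count.
  by case: (ltngtP c c') => // ?; [|symmetry]; apply: wlog_lt.
case: H => _ _ _ oc [i ri gi] _.
have : closing_count n g0 k d c < closing_count n g0 k d c'; last by rewrite eq_count ltnn.
by apply: (@count_lt _ _ _ i); rewrite ?gi; lia.
Qed.

Lemma count_right n (g0 : nat -> nat) k d :
  count (fun i => (k.+1 < i) && (g0 k < g0 i)) (iota 0 n) =
  charge_count n g0 k d + count (fun i => (k + d.+1 < i) && (g0 k < g0 i)) (iota 0 n).
Proof. by apply: count_split => i _; lia. Qed.

Lemma chargeable_count n g0 k d c : chargeable n g0 k d c ->
  charge_count n g0 k d + closing_count n g0 k d c <
  count (fun i => (k.+1 < i) && (g0 k < g0 i)) (iota 0 n).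
Proof.
case=> _ rn _ oc [i ri gi] _; rewrite (count_right n g0 k d) ltn_add2l.
by apply: (@count_lt _ _ _ i); rewrite ?gi ?oc ?ltnn ?andbF //; lia.
Qed.

(** The [E] highest right entries below row [k.+1] form the charge, which fixes [d]. More than [C]
    right entries remain below the closing row; the one with exactly [C] of them in columns to its
    left gives [c]. *)
Lemma chargeable_exists n g0 k E C : permutes n g0 -> k.+1 < n -> g0 k.+1 < g0 k ->
  E + C < count (fun i => (k.+1 < i) && (g0 k < g0 i)) (iota 0 n) ->
  exists d c, [/\ chargeable n g0 k d c, charge_count n g0 k d = E &
                  closing_count n g0 k d c = C].
Proof.
move=> permg kn left1 ltR.
have [d [rn Ed pos]] : exists d, [/\ k + d.+1 < n, charge_count n g0 k d = E &
    d = 0 \/ g0 k < g0 (k + d.+1)].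
  case: E ltR => [|E] ltR.
    exists 0; split; [by lia| |by left].
    rewrite /charge_count (@eq_count_iota _ _ pred0) ?count_pred0 // => i _ /=; lia.
  have [||x|x] := @discrete_ivt (charge_count n g0 k) 0 (n - k.+2) E.
  - by [].
  - rewrite {1}/charge_count (@eq_count_iota _ _ pred0) ?count_pred0 => [|i _ /=]; last by lia.
    rewrite /= (_ : charge_count _ _ _ _ = count (fun i => (k.+1 < i) && (g0 k < g0 i)) (iota 0 n)).
      by lia.
    by apply: eq_count_iota => i lt_in; lia.
  - case: (boolP ((k + x.+2 < n) && (g0 k < g0 (k + x.+2)))) => [/andP[lt_n lt_g]|nlt].
      by apply: (@count_leS _ _ _ (k + x.+2)) => i lt_in; lia.
    apply/leqW/eq_leq/eq_count_iota => i lt_in.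
    by move: lt_in; case: (eqVneq i (k + x.+2)) => [->|ne]; lia.
  move=> lt_x [Ex0 Ex]; exists x.+1; split; [by lia|by []|right].
  case: (ltnP (g0 k) (g0 (k + x.+2))) => // le_g.
  suff eqx : charge_count n g0 k x = charge_count n g0 k x.+1 by lia.
  apply: eq_count_iota => i lt_in.
  by move: lt_in; case: (eqVneq i (k + x.+2)) => [->|ne]; lia.
have [||x|x] := @discrete_ivt (fun x => count (fun i => (k + d.+1 < i) && (g0 k < g0 i < x)) (iota 0 n))
    (g0 k).+1 n C.
- by case: permg => bd _; apply: bd; lia.
- rewrite {1}(@eq_count_iota _ _ pred0) ?count_pred0 => [|i _ /=]; last by lia.
  move: ltR; rewrite (count_right _ _ _ d) Ed ltn_add2l /=.
  congr (_ < _); apply: eq_count_iota => i lt_in.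
  by case: permg => bd _; have := bd i lt_in; lia.
- case: (boolP (has (fun i => (k + d.+1 < i) && (g0 i == x)) (iota 0 n))) => [/hasP[i]|/hasPn none].
    rewrite mem_iota => /andP[_ lt_in] /andP[ri /eqP gi].
    apply: (@count_leS _ _ _ i) => i' lt_i' /andP[ri' gi'].
    by case: (eqVneq (g0 i') x) => [gx|gx]; [rewrite (_ : i' = i) ?eqxx ?orbT //; apply: permg.2; rewrite ?gi | lia].
  apply/leqW/eq_leq/eq_count_iota => i lt_in.
  by have := none i; rewrite mem_iota /=; lia.
move=> lt_x [Ex Ex1]; exists d, x; split=> //.
split=> //; first by lia.
case: (boolP (has (fun i => (k + d.+1 < i) && (g0 i == x)) (iota 0 n))) => [/hasP[i]|/hasPn none].
  by rewrite mem_iota => /andP[_ lt_in] /andP[ri /eqP gi]; exists i => //; lia.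
suff eqx : count (fun i => (k + d.+1 < i) && (g0 k < g0 i < x)) (iota 0 n) =
    count (fun i => (k + d.+1 < i) && (g0 k < g0 i < x.+1)) (iota 0 n) by move: eqx; lia.
apply: eq_count_iota => i lt_in.
by have := none i; rewrite mem_iota /=; lia.
Qed.

Local Open Scope ring_scope.

(** * Reflection and the neutralizing procedure *)

Lemma barK n (A : 'M[int]_n) : bar (bar A) = A.
Proof. by apply/matrixP=> i j; rewrite !mxE rev_ordK. Qed.

Lemma negativeE n (A : 'M[int]_n) : in_A1 A ->
  negative A = ~~ positive A && ~~ neutral A.
Proof.
move/in_A1_valid=> [f [k [r [s [o [c [V ->]]]]]]].
rewrite (asm_negative V) (asm_positive V) (asm_neutral V).
have := @enclosed_neq n f k r s o c V r.-1; case: V; lia.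
Qed.

Lemma positive_not_neutral n (A : 'M[int]_n) : positive A -> neutral A = false.
Proof. by rewrite /positive /neutral; case/andP; lia. Qed.

Lemma bar_A1 n (A : 'M[int]_n) : in_A1 A ->
  [/\ in_A1 (bar A), orow (bar A) = orow A, neutral (bar A) = neutral A,
      positive (bar A) = negative A & negative (bar A) = positive A].
Proof.
move/in_A1_valid=> [f [k [r [s [o [c [V ->]]]]]]].
rewrite (bar_asm V); have Vb := bar_valid V.
rewrite (asm_in_A1 Vb) (asm_orow Vb) (asm_orow V) (asm_neutral Vb) (asm_neutral V).
rewrite (asm_positive Vb) (asm_positive V) (asm_negative Vb) (asm_negative V).
have := @enclosed_neq n f k r s o c V r.-1; case: V => kr rs sn fk fs fro oc cn bd _ _.
rewrite /bar_row => enc; have bdr := bd r.-1.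
by split=> //; case: ltnP => //= k1r; rewrite (_ : (r.-1 == r) = false); lia.
Qed.

(** In a neutral matrix the leading [1] is the left [1] of the closing row, so the leading cell is
    the mirror image of the closing cell, up to entries of row [r] that vanish. *)
Lemma bar_neutral_cpar n (A : 'M[int]_n) : in_A0 A -> cpar (bar A) = ell A.
Proof.
case/andP=> /in_A1_valid[f [k [r [s [o [c [V ->]]]]]]].
rewrite (asm_neutral V) => /eqP rk.
rewrite (bar_asm V) (asm_cpar (bar_valid V)); case: (V) => kr rs sn fk fs fro oc cn bd _ _.
rewrite (@asm_ell _ _ _ _ _ _ _ V r) //; [|lia|lia].
congr Posz; apply: eq_count_iota => i lt_in; rewrite /bar_row.
case: (eqVneq i r) => [->|ir]; first by rewrite !ltnn andbF.
have := bd i lt_in; lia.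
Qed.

Lemma bar_neutral_ell n (A : 'M[int]_n) : in_A0 A -> ell (bar A) = cpar A.
Proof.
move=> A0; rewrite -{2}[A]barK bar_neutral_cpar //.
by case/andP: A0 => A1 neu; have [A1b _ neub _ _] := bar_A1 A1; rewrite /in_A0 A1b neub.
Qed.

Lemma inversions_bar_A1 n (A B : 'M[int]_n) : in_A1 A -> in_A1 B ->
  inversions A + inversions (bar A) = inversions B + inversions (bar B).
Proof.
move/in_A1_valid=> [f [k [r [s [o [c [VA ->]]]]]]].
move/in_A1_valid=> [f' [k' [r' [s' [o' [c' [VB ->]]]]]]].
have := inversions_asm_bar VA; have := inversions_asm_bar VB; lia.
Qed.

Lemma Epar_bar n (A : 'M[int]_n) : in_A1 A -> Epar (bar A) = - Epar A.
Proof.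
move=> A1; rewrite /Epar; have [_ _ neu -> ->] := bar_A1 A1.
rewrite barK (negativeE A1); case: (boolP (positive A)) => [pos|_] //=; case: ifP => _.
all: by rewrite ?opprK ?oppr0.
Qed.

Lemma in_PN_A1 n (A : 'M[int]_n) : in_PN A -> in_A1 A.
Proof. by case/andP. Qed.

Lemma in_PN_negative n (A : 'M[int]_n) : in_PN A -> negative A = false.
Proof. by case/andP=> A1; rewrite (negativeE A1); case: (positive A) => //= ->. Qed.

(** The charged cell of a neutral matrix is empty, so the same formula serves both kinds of
    matrices. *)
Lemma in_PN_Epar n (A : 'M[int]_n) : in_PN A -> Epar A = charge A.
Proof.
move=> PN; rewrite /Epar (in_PN_negative PN); case: ifP => // npos.
have [g0 [k [d [c [H eA]]]]] := in_PN_charged PN; have := chargedP H.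
rewrite -eA => -[[_ _ _ neu pos] -> _ _ _].
have -> : d = 0%N.
  by case: (ch_pos H) => // lt; move: npos; rewrite pos lt andbT; case: posnP.
by rewrite /charge_count (@eq_count_iota _ _ pred0) ?count_pred0 // => i _ /=; lia.
Qed.

Lemma in_PN_Epar_ge0 n (A : 'M[int]_n) : in_PN A -> 0 <= Epar A.
Proof.
move=> PN; rewrite in_PN_Epar //.
by have [g0 [k [d [c [H ->]]]]] := in_PN_charged PN; have [_ -> _ _ _] := chargedP H.
Qed.

(** In a positive matrix the lowest enclosed row already contributes to the charge; in terms of [g0]
    it is row [k + d.+1]. *)
Lemma in_PN_Epar0 n (A : 'M[int]_n) : in_PN A -> Epar A = 0 -> neutral A.
Proof.
move=> PN; rewrite in_PN_Epar //.
have [g0 [k [d [c [H ->]]]]] := in_PN_charged PN; have [[_ _ _ -> _] -> _ _ _] := chargedP H.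
case: (ch_pos H) => [->//|lt] [] /eqP.
case: (posnP d) => [->//|d_gt0]; rewrite -leqn0 leqNgt /charge_count -has_count.
case: hasP => // -[].
by exists (k + d.+1)%N; [rewrite mem_iota; case: H | rewrite lt; lia].
Qed.

Lemma in_A0_PN n (A : 'M[int]_n) : in_A0 A -> in_PN A.
Proof. by case/andP=> A1 neu; rewrite /in_PN A1 neu orbT. Qed.

Lemma in_A0_Epar n (A : 'M[int]_n) : in_A0 A -> Epar A = 0.
Proof.
move=> A0; have PN := in_A0_PN A0; case/andP: A0 => A1 neu.
rewrite /Epar (in_PN_negative PN); case: ifP => // /positive_not_neutral.
by rewrite neu.
Qed.

Lemma ell_ge0 n (A : 'M[int]_n) : in_PN A -> 0 <= ell A.
Proof.
by move=> /in_PN_charged[g0 [k [d [c [H ->]]]]]; have [_ _ _ -> _] := chargedP H.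
Qed.

Lemma cpar_ge0 n (A : 'M[int]_n) : in_PN A -> 0 <= cpar A.
Proof.
by move=> /in_PN_charged[g0 [k [d [c [H ->]]]]]; have [_ _ -> _ _] := chargedP H.
Qed.

(** The discharged matrix gives back [g0], but only on indices below [n], so [chargeable] is first
    transferred from [g1] to [g0]. Then the charge fixes [d] and the closing parameter fixes [c]. *)
Lemma Delta_inj n (A B : 'M[int]_n) : in_PN A -> in_PN B -> Delta A = Delta B -> A = B.
Proof.
move=> PA PB; rewrite /Delta !in_PN_Epar //.
move: PA PB => /in_PN_charged[g0 [k [d [c [HA ->]]]]] /in_PN_charged[g1 [k1 [d1 [c1 [HB ->]]]]].
have [[_ -> -> _ _] -> -> _ _] := chargedP HA.
have [[_ -> -> _ _] -> -> _ _] := chargedP HB.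
case=> ek emat ec ed; subst k1.
have eg i : (i < n)%N -> g0 i = g1 i by apply: perm_mat_inj (ch_perm HA) emat i.
have ek : g0 k = g1 k by apply: eg; case: HA; lia.
have edr : g0 (k + d1.+1)%N = g1 (k + d1.+1)%N by apply: eg; case: HB.
have HB' : chargeable n g0 k d1 c1.
  case: HB => _ rn left1 right1 [i ri gi] pos; split; rewrite ?ek ?edr //.
  - by case: HA.
  - by rewrite eg //; lia.
  - by exists i => //; rewrite eg //; lia.
have ec' : closing_count n g0 k d c = closing_count n g0 k d1 c1.
  rewrite ec /closing_count ek; apply: eq_count_iota => i lt_in; by rewrite eg.
have ed' : charge_count n g0 k d = charge_count n g0 k d1.
  rewrite ed /charge_count ek; apply: eq_count_iota => i lt_in; by rewrite eg.
have edd := charge_count_inj (ch_lt HA) (ch_lt HB') (ch_pos HA) (ch_pos HB') ed'; subst d1.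
rewrite (closing_count_inj HA HB' ec').
by apply: charged_ext => //; case: HA.
Qed.

(** The bound of [chargeable_count] involves only the sum of the two parameters. With [y = 0] this
    yields the neutral partner of [A]; applied to a neutral matrix with [y = E], it yields the
    preimages under [Lambda]. *)
Lemma Delta_transfer n (A : 'M[int]_n) (x y : int) : in_PN A -> 0 <= x -> 0 <= y ->
  x + y = cpar A + Epar A ->
  exists2 B, in_PN B & Delta B = (orow A, delta A, x, y).
Proof.
move=> PA; case: x y => // C [] // E _ _; rewrite /Delta in_PN_Epar //.
move: PA => /in_PN_charged[g0 [k [d [c [HA ->]]]]].
have [[_ -> -> _ _] -> -> _ _] := chargedP HA => -[eCE].
have := chargeable_count HA; case: (HA) => permg rn left1 _ _ _ ltR.
have [||d' [c' [HB eE eC]]] := @chargeable_exists n g0 k E C permg _ left1.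
- by lia.
- by apply: leq_ltn_trans ltR; lia.
have [[A1 eo ed neu pos] ech ecp _ _] := chargedP HB.
have PB : in_PN (charged n g0 k d' c').
  rewrite /in_PN A1 pos neu /=; case: (ch_pos HB) => [->//|->].
  by case: posnP => // ->.
by exists (charged n g0 k d' c') => //; rewrite eo ed ecp in_PN_Epar // ech eE eC.
Qed.

Lemma Delta_share n (A B : 'M[int]_n) : in_PN A -> in_PN B ->
  orow A = orow B -> delta A = delta B ->
  [/\ ell A = ell B, forall i j : 'I_n, (i <= orow A)%N -> A i j = B i j &
      inversions A - Epar A - cpar A = inversions B - Epar B - cpar B].
Proof.
move=> PA PB; rewrite !in_PN_Epar //.
move: PA PB => /in_PN_charged[g0 [k [d [c [HA ->]]]]] /in_PN_charged[g1 [k1 [d1 [c1 [HB ->]]]]].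
have [[_ -> -> _ _] _ _ -> [topA ->]] := chargedP HA.
have [[_ -> -> _ _] _ _ -> [topB ->]] := chargedP HB.
move=> ek emat; subst k1.
have eg i : (i < n)%N -> g0 i = g1 i by apply: perm_mat_inj (ch_perm HA) emat i.
split.
- congr Posz; apply: eq_count_iota => i lt_in; case: HA => _ rn _ _ _ _.
  by rewrite !eg //; lia.
- by move=> i j ik; rewrite topA // topB // eg.
- by rewrite emat; ring.
Qed.

Lemma toZ_onto n (A : 'M[int]_n) : in_A1 A -> exists M, toZ M = A.
Proof.
case/andP=> /and3P[/'forall_forallP ok _ _] _.
exists (\matrix_(i, j) inord (absz (A i j + 1))); apply/matrixP=> i j; rewrite !mxE.
by have := ok i j; rewrite !inE => /or3P[] /eqP ->; rewrite inordK.
Qed.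

(** The [pick] succeeds, by [Delta_transfer] with charge 0, so the default value in [Lambda_pn] is
    never returned. What it finds is neutral because its charge is 0. *)
Lemma Lambda_pnP n (A : 'M[int]_n) : in_PN A -> exists N,
  [/\ Lambda_pn A = (N, Epar A), in_A0 N, orow N = orow A, delta N = delta A &
      cpar N = cpar A + Epar A].
Proof.
move=> PA; rewrite /Lambda_pn; case: pickP => [M /andP[PM /eqP[eo ed ec eE]]|none].
  exists (toZ M); split=> //; rewrite /in_A0 in_PN_A1 //=.
  exact: in_PN_Epar0.
have x0 : 0 <= cpar A + Epar A by rewrite addr_ge0 ?cpar_ge0 ?in_PN_Epar_ge0.
have [B PB eB] := Delta_transfer PA x0 (lexx 0) (addr0 _).
have [M eM] := toZ_onto (in_PN_A1 PB).
by have := none M; rewrite eM PB eB eqxx.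
Qed.

Lemma Lambda_PN n (A : 'M[int]_n) : in_PN A -> Lambda A = Lambda_pn A.
Proof. by move=> PA; rewrite /Lambda in_PN_negative. Qed.

Lemma Lambda_negative n (A : 'M[int]_n) : negative A ->
  Lambda A = (bar (Lambda_pn (bar A)).1, - (Lambda_pn (bar A)).2).
Proof. by rewrite /Lambda => ->. Qed.

Lemma in_A1_PN n (A : 'M[int]_n) : in_A1 A -> in_PN A = ~~ negative A.
Proof.
move=> A1; rewrite /in_PN A1 (negativeE A1) /=.
by case: (positive A) (neutral A) => [] [].
Qed.

Lemma bar_in_A0 n (A : 'M[int]_n) : in_A0 A -> in_A0 (bar A).
Proof.
by case/andP=> A1 neu; have [A1b _ neub _ _] := bar_A1 A1; rewrite /in_A0 A1b neub.
Qed.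

Lemma bar_negative n (A : 'M[int]_n) : in_A1 A -> negative A ->
  [/\ in_PN (bar A), positive (bar A) & 0 < Epar (bar A)].
Proof.
move=> A1 negA; have [A1b _ neub posb _] := bar_A1 A1.
have posbA : positive (bar A) by rewrite posb.
have PN : in_PN (bar A) by rewrite /in_PN A1b posbA.
split=> //; rewrite lt_def in_PN_Epar_ge0 // andbT.
by apply/negP => /eqP /(in_PN_Epar0 PN); rewrite positive_not_neutral.
Qed.

Lemma rpar_eq n (A B : 'M[int]_n) :
  (forall i j : 'I_n, (i <= 0)%N -> A i j = B i j) -> rpar A = rpar B.
Proof.
move=> eqAB; rewrite /rpar; have : {subset iota 0 n <= gtn n} by move=> j; rewrite mem_iota.
elim: (iota 0 n) => //= j s IH sub; rewrite IH => [|x xs]; last by apply: sub; rewrite inE xs orbT.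
have lt_jn : (j < n)%N by apply: sub; rewrite mem_head.
have lt_0n : (0 < n)%N by lia.
by have := eqAB (Ordinal lt_0n) (Ordinal lt_jn) isT; rewrite -!entE /= => ->.
Qed.

(** * Bijectivity of the neutralizing procedure *)

Lemma Lambda_in_N1 n (A : 'M[int]_n) : in_A1 A -> in_N1 (Lambda A).
Proof.
move=> A1; case: (boolP (negative A)) => [negA|]; last first.
  rewrite -in_A1_PN // => PA; rewrite (Lambda_PN PA).
  have [N [-> N0 _ _ eC]] := Lambda_pnP PA; rewrite /in_N1 N0 /=.
  have := in_PN_Epar_ge0 PA; have := cpar_ge0 PA; have := ell_ge0 (in_A0_PN N0); lia.
have [PA _ _] := bar_negative A1 negA; rewrite (Lambda_negative negA).
have [N [-> N0 _ _ eC]] := Lambda_pnP PA; rewrite /in_N1 /= bar_in_A0 //=.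
(* Reflection exchanges the two bounds, so the upper bound on [Epar (bar A)] becomes the lower bound
   required here. *)
rewrite bar_neutral_ell // bar_neutral_cpar //.
have := in_PN_Epar_ge0 PA; have := cpar_ge0 PA; have := ell_ge0 (in_A0_PN N0); lia.
Qed.

Lemma Lambda_snd n (A : 'M[int]_n) : in_A1 A -> (Lambda A).2 = Epar A.
Proof.
move=> A1; case: (boolP (negative A)) => [negA|]; last first.
  by rewrite -in_A1_PN // => PA; rewrite (Lambda_PN PA).
by rewrite (Lambda_negative negA) /= Epar_bar // opprK.
Qed.

Lemma Lambda_pn_inj n (A B : 'M[int]_n) : in_PN A -> in_PN B ->
  Lambda_pn A = Lambda_pn B -> A = B.
Proof.
move=> PA PB; have [N [-> N0 eo ed ec]] := Lambda_pnP PA.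
have [N' [-> N0' eo' ed' ec']] := Lambda_pnP PB.
case=> eN eE; apply: Delta_inj => //; subst N'.
by rewrite /Delta -eo -ed eo' ed' eE; congr (_, _, _, _); lia.
Qed.

(** The second component of [Lambda A] is [Epar A], whose sign tells whether [A] is negative. Hence
    [A] and [B] go through the same branch of [Lambda]. *)
Lemma Lambda_inj n (A B : 'M[int]_n) : in_A1 A -> in_A1 B -> Lambda A = Lambda B -> A = B.
Proof.
move=> A1 B1 eqL; have eE : Epar A = Epar B by rewrite -!Lambda_snd ?eqL.
have negE (C : 'M[int]_n) : in_A1 C -> negative C = (Epar C < 0).
  move=> C1; apply/idP/idP => [negC|]; last by apply: contraTT; rewrite -in_A1_PN // -leNgt => /in_PN_Epar_ge0.
  by have [_ _] := bar_negative C1 negC; rewrite Epar_bar // oppr_gt0.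
have eneg : negative A = negative B by rewrite !negE // eE.
case: (boolP (negative A)) => [negA|npA].
  have negB : negative B by rewrite -eneg.
  have [PA _ _] := bar_negative A1 negA; have [PB _ _] := bar_negative B1 negB.
  rewrite -[A]barK -[B]barK; congr bar; apply: Lambda_pn_inj => //.
  have [N [eN _ _ _ _]] := Lambda_pnP PA; have [N' [eN' _ _ _ _]] := Lambda_pnP PB.
  move: eqL; rewrite !Lambda_negative // eN eN' /= => -[eNN /oppr_inj ->].
  by rewrite -[N]barK eNN barK.
have [PA PB] : in_PN A /\ in_PN B by rewrite !in_A1_PN // -eneg.
by apply: Lambda_pn_inj; rewrite // -!Lambda_PN.
Qed.

Lemma Lambda_pn_onto n (N : 'M[int]_n) (E : int) : in_A0 N -> 0 <= E <= cpar N ->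
  exists2 A, in_PN A & Lambda_pn A = (N, E).
Proof.
move=> N0 /andP[E0 Ec].
have cE : 0 <= cpar N - E by rewrite subr_ge0.
have eqC : cpar N - E + E = cpar N + Epar N by rewrite in_A0_Epar // subrK addr0.
have [A PA eA] := Delta_transfer (in_A0_PN N0) cE E0 eqC.
exists A => //; have [N' [-> N0' eo ed ec]] := Lambda_pnP PA.
case: eA => eo' ed' ec' eE; rewrite eE; congr (_, _).
apply: Delta_inj; rewrite ?in_A0_PN // /Delta !in_A0_Epar // eo ed ec eo' ed' ec' eE.
by rewrite subrK.
Qed.

Lemma Lambda_onto n (p : 'M[int]_n * int) : in_N1 p -> exists2 A, in_A1 A & Lambda A = p.
Proof.
case: p => N E /andP[/= N0 /andP[lE Ec]]; case: (leP 0 E) => [E0|E0].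
  have [|A PA eA] := @Lambda_pn_onto n N E N0; first by rewrite E0.
  by exists A; [apply: in_PN_A1 | rewrite Lambda_PN].
have [|A PA eA] := @Lambda_pn_onto n (bar N) (- E) (bar_in_A0 N0).
  by rewrite bar_neutral_cpar //; lia.
have A1 := in_PN_A1 PA; have [A1b _ _ _ negb] := bar_A1 A1.
have EA : Epar A = - E by have := Lambda_snd A1; rewrite (Lambda_PN PA) eA.
(* The charge [- E] is nonzero, which excludes a neutral [A]; thus [bar A] is negative and [Lambda]
   takes its reflected branch on it. *)
have posA : positive A.
  case/andP: (PA) => _ /orP[//|neu]; have A0 : in_A0 A by rewrite /in_A0 A1.
  by move: EA E0; rewrite in_A0_Epar //; lia.
exists (bar A) => //; rewrite Lambda_negative ?negb // barK eA /= barK opprK //.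
Qed.

Lemma Lambda_props_PN n (A : 'M[int]_n) : in_PN A ->
  let N := (Lambda A).1 in
  [/\ in_A0 N, (in_A0 A -> N = A),
     [/\ orow N = orow A & forall i j : 'I_n, (i <= orow A)%N -> N i j = A i j] &
     [/\ inversions N = inversions A, cpar N = cpar A + Epar A & ell N = ell A]].
Proof.
move=> PA; rewrite (Lambda_PN PA); have [N [-> N0 eo ed ec]] := Lambda_pnP PA => /=.
have PN := in_A0_PN N0; have [eell top einv] := Delta_share PN PA eo ed.
split=> //.
- move=> A0; apply: Delta_inj => //.
  by rewrite /Delta eo ed ec !in_A0_Epar // addr0.
- by split=> // i j ik; apply: top; rewrite eo.
- by split=> //; move: einv; rewrite ec in_A0_Epar //; lia.
Qed.

Lemma Lambda_bar n (A : 'M[int]_n) : in_A1 A ->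
  Lambda (bar A) = (bar (Lambda A).1, - (Lambda A).2).
Proof.
move=> A1; have [A1b _ neub posb negb] := bar_A1 A1.
case: (boolP (negative A)) => [negA|].
  have [PA _ _] := bar_negative A1 negA.
  rewrite (Lambda_negative negA) (Lambda_PN PA).
  by case: (Lambda_pn (bar A)) => M E; rewrite barK opprK.
rewrite -in_A1_PN // => PA; case/andP: (PA) => _ /orP[posA|neuA].
  by rewrite (Lambda_negative (A := bar A)) ?negb // barK (Lambda_PN PA).
(* The reflection of a neutral matrix is neutral, so here neither side takes the reflected branch;
   both matrices are fixed, with charge 0. *)
have A0 : in_A0 A by rewrite /in_A0 A1.
have A0b := bar_in_A0 A0.
have [_ /(_ A0) eA _ _] := Lambda_props_PN PA.
have [_ /(_ A0b) eAb _ _] := Lambda_props_PN (in_A0_PN A0b).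
by rewrite [LHS]surjective_pairing eA eAb !Lambda_snd // Epar_bar.
Qed.

Theorem theorem1 (n : nat) :
  [/\ (forall A : 'M[int]_n, in_A1 A -> in_N1 (Lambda A)),
      (forall A B : 'M[int]_n, in_A1 A -> in_A1 B -> Lambda A = Lambda B -> A = B),
      (forall p : 'M[int]_n * int, in_N1 p -> exists2 A, in_A1 A & Lambda A = p) &
      (forall A : 'M[int]_n, in_A1 A ->
        let N := (Lambda A).1 in let E := (Lambda A).2 in
        [/\ (in_A0 A <-> N = A),
            Lambda (bar A) = (bar N, - E),
            [/\ orow N = orow A,
                (forall i j : 'I_n, (i <= orow A)%N -> N i j = A i j) &
                rpar A = rpar N] &
            [/\ inversions N = inversions A, E = Epar A, Bpar N = Bpar A + Epar A &
                Jpar N = Jpar A]])].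
Proof.
split; [exact: Lambda_in_N1 | exact: Lambda_inj | exact: Lambda_onto |].
move=> A A1 /=; have N1 := Lambda_in_N1 A1; have eE := Lambda_snd A1.
have N0 : in_A0 (Lambda A).1 by case/andP: N1.
have negN := in_PN_negative (in_A0_PN N0); have EN := in_A0_Epar N0.
have [A0N [eo top] [einv eB eJ]] : [/\ (in_A0 A -> (Lambda A).1 = A),
    orow (Lambda A).1 = orow A /\
      forall i j : 'I_n, (i <= orow A)%N -> (Lambda A).1 i j = A i j &
    [/\ inversions (Lambda A).1 = inversions A, Bpar (Lambda A).1 = Bpar A + Epar A &
     Jpar (Lambda A).1 = Jpar A]].
  rewrite /Bpar /Jpar negN EN; case: (boolP (negative A)) => [negA|]; last first.
    rewrite -in_A1_PN // => PA; have [_ A0N eo [einv -> ->]] := Lambda_props_PN PA.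
    have E0 := in_PN_Epar_ge0 PA; split=> //; split=> //; first by ring.
    by move: E0; lia.
  have [PA _ _] := bar_negative A1 negA.
  have [M0 _ [eo top] [einv ec el]] := Lambda_props_PN PA.
  have [A1b orowb neub _ _] := bar_A1 A1.
  have EbA := Epar_bar A1; have E0 := in_PN_Epar_ge0 PA.
  have eL : (Lambda A).1 = bar (Lambda (bar A)).1 by rewrite Lambda_bar //= barK.
  have [M1 neuM] := andP M0; have [_ orowM _ _ _] := bar_A1 M1.
  (* The inversion numbers of a matrix and its reflection have a constant sum, so equality for
     [bar A] and its partner gives equality for [A] and its own. *)
  have invM := inversions_bar_A1 M1 A1b; rewrite barK in invM.
  rewrite eL; split.
  - by case/andP=> _ neuA; move: negA; rewrite (negativeE A1) neuA andbF.
  - split; first by rewrite orowM eo.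
    by move=> i j ik; rewrite mxE top ?orowb // mxE rev_ordK.
  - rewrite bar_neutral_cpar // bar_neutral_ell // ec el EbA.
    split; [by apply: (addrI (inversions (Lambda (bar A)).1)); rewrite invM einv | by ring |].
    by move: E0; rewrite EbA; move: (Epar A) (cpar _) (ell _) => x y z; clear; lia.
split=> //; last by split=> //; apply: rpar_eq => i j i0; rewrite top //; lia.
(* The first component of [Lambda A] is always neutral, which gives the converse. *)
- by split=> [/A0N //|<-].
- exact: Lambda_bar.
Qed.
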